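(* Let $\mathbf{W}\in l^2_s(\mathbb{Z}^2)$ for all $s>1$ and $\omega^2=\frac{|n|^2}{4}+\epsilon\Omega$ for some $n\in\mathbb{N}^2$ and $\Omega\in\mathbb{R}$. Let $$S_n=\{m\in\mathbb{Z}_1'\times\mathbb{Z}_2':\ |m|^2=|n|^2\}$$ and let $d_S={\rm Dim}(S_n)$ be its number of elements. The nonlinear lattice system $$\left(\omega^2-\frac{|m|^2}{4}\right)U_m+\epsilon\sum_{m_1\in\mathbb{Z}_1'\times\mathbb{Z}_2'}w_{m-m_1}U_{m_1}=\epsilon\sigma\sum_{m_1\in\mathbb{Z}_1'\times\mathbb{Z}_2'}\ \sum_{m_2\in\mathbb{Z}_1'\times\mathbb{Z}_2'}U_{m_1}\bar U_{-m_2}U_{m-m_1-m_2},\qquad m\in\mathbb{Z}_1'\times\mathbb{Z}_2',$$ has a non-trivial solution $\mathbf{U}\in l^2_s(\mathbb{Z}_1'\times\mathbb{Z}_2')$ for all $s>1$ and sufficiently small $\epsilon$ if and only if there exists a non-trivial solution $\mathbf{a}\in\mathbb{C}^{d_S}$ of the bifurcation equations $$\Omega a_{j_m}+\sum_{m_1\in S_n}w_{m-m_1}a_{j_{m_1}}-\sigma\sum_{m_1\in S_n}\ \sum_{-m_2\in S_n'}a_{j_{m_1}}\bar a_{j_{-m_2}}a_{j_{m-m_1-m_2}}=\epsilon A_{j_m,\epsilon}(\mathbf{a}),\qquad\forall m\in S_n,$$ where $j_m$ is the index of $m$ in the set $S_n$, the set $S_n'$ is the subset of those $-m_2\in S_n$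 such that $m-m_1-m_2\in S_n$, and $\mathbf{A}_\epsilon(\mathbf{a})\in\mathbb{C}^{d_S}$ depends analytically on $\epsilon$ near $\epsilon=0$. Moreover, there exists a constant $C>0$ which is independent of $\epsilon_0>0$ and depends on $\delta>0$ such that $$\forall|\epsilon|<\epsilon_0,\ \forall\|\mathbf{a}\|_{l^1(\mathbb{C}^{d_S})}<\delta:\quad\|\mathbf{A}_\epsilon(\mathbf{a})\|_{l^1(\mathbb{C}^{d_S})}\le C\|\mathbf{a}\|_{l^1(\mathbb{C}^{d_S})},$$ where $\epsilon_0$ is sufficiently small and $\delta$ is fixed independently of $\epsilon_0$.
   Context: The lattice system is the Fourier form of the two-dimensional elliptic problem $\nabla^2U+\omega^2U+\epsilon W(x)U=\sigma|U|^2U$, $x\in\mathbb{R}^2$, $U:\mathbb{R}^2\to\mathbb{C}$, where $\omega^2,\epsilon,\sigma$ are real parameters and $W:\mathbb{R}^2\to\mathbb{R}$ is bounded and $2\pi$-periodic in each variable, with the expansions $W(x)=\sum_{m\in\mathbb{Z}^2}w_{2m}e^{im\cdot x}$ and $U(x)=\sqrt\epsilon\sum_{m\in\mathbb{Z}_1'\times\mathbb{Z}_2'}U_me^{\frac i2m\cdot x}$. $\mathbf{W}$ denotes the sequence of Fourier coefficients $\{w_{2m}\}_{m\in\mathbb{Z}^2}$ and $\mathbf{U}=\{U_m\}$. For $n=(n_1,n_2)$, $|n|=\sqrt{n_1^2+n_2^2}$. For $j=1,2$, $\mathbb{Z}_j'$ is the set of all even integers if $n_j$ is even and the set of all odd integers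 if $n_j$ is odd. The space $l^2_s$ on a sublattice is the weighted space with norm $\|\mathbf{U}\|^2_{l^2_s}=\sum_m\left(1+\frac{|m|^2}{4}\right)^s|U_m|^2<\infty$ (for the potential, indexed by $2m$: $\sum_{m\in\mathbb{Z}^2}(1+|m|^2)^s|w_{2m}|^2<\infty$). $\|\mathbf{a}\|_{l^1(\mathbb{C}^{d_S})}=\sum_{j=1}^{d_S}|a_j|$.
   Formalization: The equivalence is proved for ε≠0, for ‖a‖<δ and U with l¹ norm <δ on S_n and <ρ off S_n (δ, ρ arbitrary, ε small depending on them): at ε=0 it fails, and for W=0, n=(1,3), σ=1, Ω=-1 large single-site U of size ~|ε|^{-1/2} break it. *)

(* Defs.v *)
(* Complex numbers are R[i]; limits in R[i] are taken in (R[i])^o, which carries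
   the topology of the norm. *)
From HB Require Import structures.
From mathcomp Require Import all_boot all_order all_algebra finmap.
From mathcomp Require Import all_classical all_reals all_analysis.
From mathcomp Require Import complex zify.
From mathcomp.analysis.showcase Require summability.

Set Implicit Arguments.
Unset Strict Implicit.
Unset Printing Implicit Defensive.

Import Order.TTheory GRing.Theory Num.Theory.
Import numFieldNormedType.Exports.

Local Open Scope classical_set_scope.
Local Open Scope ring_scope.
Local Open Scope complex_scope.

Notation Z2 := (int * int)%type.

Definition normsq (m : Z2) : int := m.1 ^+ 2 + m.2 ^+ 2.

Definition natZ2 (n : nat * nat) : Z2 := (n.1%:Z, n.2%:Z).

(* Z_1' x Z_2' : each component has the parity of the same component of n.
   In particular sublattice (0, 0) is (2Z)^2. *)
Definition sublattice (n : nat * nat) : set Z2 :=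
  [set m | (m.1 = (natZ2 n).1 %[mod 2])%Z /\ (m.2 = (natZ2 n).2 %[mod 2])%Z].

Definition resonant_set (n : nat * nat) : set Z2 :=
  [set m | sublattice n m /\ normsq m = normsq (natZ2 n)].

Lemma finite_resonant_set n : finite_set (resonant_set n).
Proof.
pose N := (n.1 + n.2)%N.
pose f (p : 'I_N.*2.+1 * 'I_N.*2.+1) : Z2 :=
  ((p.1 : nat)%:Z - N%:Z, (p.2 : nat)%:Z - N%:Z).
apply: (@sub_finite_set _ _ (f @` setT)); last exact/finite_image/finite_finset.
move=> [x y] [_]; rewrite /normsq /natZ2 /= => e.
have hx : (`|x| <= N)%N by rewrite /N; nia.
have hy : (`|y| <= N)%N by rewrite /N; nia.
have a1 : (`|(x + N%:Z)%R| < N.*2.+1)%N by lia.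
have a2 : (`|(y + N%:Z)%R| < N.*2.+1)%N by lia.
by exists (Ordinal a1, Ordinal a2) => //; rewrite /f /=; congr (_, _); lia.
Qed.

Definition Sn (n : nat * nat) : {fset Z2} := fset_set (resonant_set n).

Lemma in_Sn n m : (m \in Sn n) = (m \in resonant_set n).
Proof. by rewrite /Sn in_fset_set //; exact: finite_resonant_set. Qed.

Definition dS (n : nat * nat) : nat := #|` Sn n|%fset.

Section Defs.
Variable R : realType.
Notation C := R[i].

Definition cnorm (z : C) : R := Normc.normc z.

(* A sequence on D is a function on Z2 whose values outside D are never used. *)

(* Unconditional sum: the limit of the sums over finite sets, ordered by
   inclusion. It is only used where the family is absolutely summable. *)
Definition csum (D : set Z2) (f : Z2 -> C) : C :=
  summability.sum ((fun m => if m \in D then f m else 0) : Z2 -> C^o).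

Definition l2s (D : set Z2) (s : R) (U : Z2 -> C) : Prop :=
  (\esum_(m in D)
     ((1 + (normsq m)%:~R / 4) `^ s * cnorm (U m) ^+ 2)%:E < +oo)%E.

Definition expi (t : R) : C := cos t +i* sin t.

Definition periodic2pi (W : R -> R -> R) : Prop :=
  forall x y, W (x + 2 * pi) y = W x y /\ W x (y + 2 * pi) = W x y.

Definition bounded2 (W : R -> R -> R) : Prop :=
  exists M : R, forall x y, `|W x y| <= M.

(* W(x) = sum over m in Z^2 of w_{2m} e^{i m.x}; only the values of w on the
   even lattice occur, here and below. *)
Definition fourier_expansion (W : R -> R -> R) (w : Z2 -> C) : Prop :=
  forall x y, (W x y)%:C =
    csum setT (fun m => w (m + m) * expi (m.1%:~R * x + m.2%:~R * y)).

(* Left-hand side minus right-hand side. *)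
Definition lattice_defect (w : Z2 -> C) (sigma omega2 eps : R)
    (n : nat * nat) (U : Z2 -> C) (m : Z2) : C :=
  let L := sublattice n in
  ((omega2 - (normsq m)%:~R / 4)%:C * U m
     + eps%:C * csum L (fun m1 => w (m - m1) * U m1))
  - eps%:C * sigma%:C *
      csum L (fun m1 => csum L (fun m2 =>
        U m1 * (U (- m2))^* * U (m - m1 - m2))).

Definition lattice_solution (w : Z2 -> C) (sigma omega2 eps : R)
    (n : nat * nat) (U : Z2 -> C) : Prop :=
  (forall s : R, 1 < s -> l2s (sublattice n) s U) /\
  (forall m, sublattice n m -> lattice_defect w sigma omega2 eps n U m = 0).

Definition nontrivial_on (D : set Z2) (U : Z2 -> C) : Prop :=
  exists2 m, D m & U m != 0.

(* The reduction acts on bounded sets: off S_n it determines U uniquely only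
   among sequences of l^1 norm less than a fixed rho, once eps is small
   depending on rho. For s > 1, l^2_s embeds continuously in l^1, so every
   l^2_s-bounded set is covered. *)
Definition in_region (n : nat * nat) (delta rho : R) (U : Z2 -> C) : Prop :=
  \sum_(m <- Sn n) cnorm (U m) < delta /\
  (\esum_(m in sublattice n `\` resonant_set n) (cnorm (U m))%:E < rho%:E)%E.

(* coef a m = a_{j_m}, where j_m is the position of m in the enumeration of
   S_n. Outside S_n it is 0, which no definition below uses. *)
Definition coef (n : nat * nat) (a : 'rV[C]_(dS n)) (m : Z2) : C :=
  if insub (index m (Sn n)) is Some j then a 0 j else 0.

Definition l1norm (d : nat) (a : 'rV[C]_d) : R := \sum_(j < d) cnorm (a 0 j).

(* The inner summation index k is -m_2. *)
Definition bif_lhs (w : Z2 -> C) (sigma Omega : R) (n : nat * nat)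
    (a : 'rV[C]_(dS n)) (m : Z2) : C :=
  Omega%:C * coef a m
  + \sum_(m1 <- Sn n) w (m - m1) * coef a m1
  - sigma%:C * \sum_(m1 <- Sn n) \sum_(k <- Sn n | m - m1 + k \in Sn n)
      coef a m1 * (coef a k)^* * coef a (m - m1 + k).

Definition bif_solution (w : Z2 -> C) (sigma Omega eps : R) (n : nat * nat)
    (A : R -> 'rV[C]_(dS n) -> 'rV[C]_(dS n)) (a : 'rV[C]_(dS n)) : Prop :=
  forall m, m \in Sn n ->
    bif_lhs w sigma Omega a m = eps%:C * coef (A eps a) m.

Definition analytic_near0 (d : nat) (eps0 : R) (f : R -> 'rV[C]_d) : Prop :=
  exists c : nat -> 'rV[C]_d, forall eps : R, `|eps| < eps0 ->
    forall j,
      series (fun k => c k 0 j * eps%:C ^+ k : C^o) @ \oo --> (f eps 0 j : C^o).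

(* A is the remainder of the Lyapunov-Schmidt reduction at a: U extends a,
   solves the equations off S_n, and the equations on S_n, divided by eps,
   are the bifurcation equations with remainder eps A. *)
Definition reduction_at (w : Z2 -> C) (sigma Omega eps delta rho : R)
    (n : nat * nat) (A : R -> 'rV[C]_(dS n) -> 'rV[C]_(dS n))
    (a : 'rV[C]_(dS n)) : Prop :=
  exists U : Z2 -> C,
    [/\ forall s : R, 1 < s -> l2s (sublattice n) s U,
        in_region n delta rho U,
        forall m, m \in Sn n -> U m = coef a m &
        forall m, sublattice n m ->
          lattice_defect w sigma
            ((normsq (natZ2 n))%:~R / 4 + eps * Omega) eps n U m =
          if m \in Sn n
          then eps%:C * (bif_lhs w sigma Omega a m - eps%:C * coef (A eps a) m)
          else 0].

End Defs.

(* Main.v *)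
(* Off the resonant set S_n the unperturbed symbol (|n|^2 - |m|^2) / 4 is bounded
   away from 0, so a sequence with resonant part a solves the nonresonant
   equations iff U = a + eps r(Q(U)), where Q collects the potential, the detuning
   Omega and the cubic term, and r is bounded on l^1. As l^1 is a convolution
   algebra, expanding U in powers of eps determines the coefficients recursively,
   and a majorant argument makes the series converge in l^1 for |eps| < e, with
   e depending only on delta and the data; the contraction estimate gives
   uniqueness in l^1 balls. The defect on S_n is eps Q(U), whose zeroth
   coefficient is the left-hand side of the bifurcation equations and whose
   higher coefficients form - eps A. Since r gains two derivatives and the
   weighted l^1 spaces are also convolution algebras, U lies in all of them. *)
Require Import Defs.
From HB Require Import structures.
From mathcomp Require Import all_boot all_order all_algebra finmap.
From mathcomp Require Import all_classical all_reals all_analysis.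
From mathcomp Require Import complex zify ring lra.
From mathcomp.analysis.showcase Require summability.

Set Implicit Arguments.
Unset Strict Implicit.
Unset Printing Implicit Defensive.

Import Order.TTheory GRing.Theory Num.Theory.
Import numFieldNormedType.Exports.

Local Open Scope classical_set_scope.
Local Open Scope ring_scope.
Local Open Scope complex_scope.

(** The cubic term contains a conjugate, so it is not complex differentiable in U, and an implicit
    function theorem over C does not apply directly. But eps is real: conjugation commutes with
    evaluating a power series at eps, so the recursion for the coefficients survives. Since
    hypothesis and conclusion concern every s > 1, l^2_s can be traded for l^1 weighted by powers of
    1 + |m|^2 at the cost of finitely many powers, and convolution estimates then need only
    exchanges of finite sums. All bounds along the series are kept linear in the norm of the
    amplitude a, while the smallness of e involves delta only. This gives a constant C independent
    of eps0, and it also shows that a = 0 forces U = 0. The radius rho enters only afterwards,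
    through two further conditions on eps: the constructed U has to lie in the region, and the
    contraction has to hold on a ball that contains both this U and every competitor. *)

(** * Real-valued modulus on the complex numbers *)

Section ComplexNorm.
Variable R : realType.
Implicit Types x y z e : R[i].

Lemma cnormE z : `|z| = (cnorm z)%:C.
Proof. by rewrite normc_def; case: z. Qed.

Lemma cnorm_ge0 z : 0 <= cnorm z.
Proof. by rewrite -lecR -cnormE normr_ge0. Qed.

Lemma cnorm0 : cnorm (0 : R[i]) = 0.
Proof. exact: Normc.normc0. Qed.

Lemma cnorm0_eq0 z : cnorm z = 0 -> z = 0.
Proof. exact: Normc.eq0_normc. Qed.

Lemma cnormM x y : cnorm (x * y) = cnorm x * cnorm y.
Proof. exact: Normc.normcM. Qed.

Lemma cnormN x : cnorm (- x) = cnorm x.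
Proof. by apply: complexI; rewrite -!cnormE normrN. Qed.

Lemma ler_cnormD x y : cnorm (x + y) <= cnorm x + cnorm y.
Proof. by rewrite -lecR rmorphD /= -!cnormE ler_normD. Qed.

Lemma ler_cnormB x y : cnorm (x - y) <= cnorm x + cnorm y.
Proof. by rewrite -(cnormN y) ler_cnormD. Qed.

Lemma cnormBC x y : cnorm (x - y) = cnorm (y - x).
Proof. by rewrite -cnormN opprB. Qed.

Lemma cnorm_real (r : R) : cnorm r%:C = `|r|.
Proof. by rewrite /cnorm /= expr0n /= addr0 sqrtr_sqr. Qed.

Lemma cnorm_conj z : cnorm z^* = cnorm z.
Proof. by case: z => a b; rewrite /cnorm /= sqrrN. Qed.

Lemma cnormX z k : cnorm (z ^+ k) = cnorm z ^+ k.
Proof. by apply: complexI; rewrite -cnormE normrX cnormE rmorphXn. Qed.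

Lemma cnormV z : cnorm z^-1 = (cnorm z)^-1.
Proof. exact: Normc.normcV. Qed.

Lemma ler_cnorm_sum (I : Type) (s : seq I) (P : pred I) (F : I -> R[i]) :
  cnorm (\sum_(i <- s | P i) F i) <= \sum_(i <- s | P i) cnorm (F i).
Proof.
elim/big_ind2 : _ => //; first by rewrite cnorm0.
by move=> x1 x2 y1 y2 h1 h2; apply: le_trans (ler_cnormD _ _) (lerD h1 h2).
Qed.

Lemma Re_le_cnorm z : `|complex.Re z| <= cnorm z.
Proof.
by case: z => a b; rewrite /cnorm /= -sqrtr_sqr ler_wsqrtr // lerDl sqr_ge0.
Qed.

Lemma Im_le_cnorm z : `|complex.Im z| <= cnorm z.
Proof.
by case: z => a b; rewrite /cnorm /= -sqrtr_sqr ler_wsqrtr // lerDr sqr_ge0.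
Qed.

Lemma gt0_realP e : 0 < e -> exists2 r : R, 0 < r & r%:C = e.
Proof.
case: e => a b; rewrite ltcE /= => /andP[/eqP-> a0].
by exists a.
Qed.

Lemma unit_phase z : exists2 u, cnorm u = 1 & u * z = (cnorm z)%:C.
Proof.
have [->|z0] := eqVneq z 0.
  by exists 1; rewrite ?mulr0 ?cnorm0 // /cnorm Normc.normc1.
have nz : cnorm z != 0 by apply: contra_neq z0 => /cnorm0_eq0.
exists ((cnorm z)%:C / z); last by rewrite divfK.
by rewrite cnormM cnormV cnorm_real ger0_norm ?cnorm_ge0 // divff.
Qed.

End ComplexNorm.

(** * Unconditional sums and the l^1 norm *)

Lemma le_sum_subset (R : numDomainType) (T : eqType) (s t : seq T)
    (F : T -> R) : uniq s -> {subset s <= t} -> (forall x, 0 <= F x) ->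
  \sum_(x <- s) F x <= \sum_(x <- t) F x.
Proof.
move=> us st F0.
have [t' pt] : exists t', perm_eq t (s ++ t').
  elim: s t us st => [|a s IH] t /=; first by exists t.
  case/andP => na us st; have at_ := st _ (mem_head a s).
  have st' : {subset s <= rem a t}.
    move=> x xs; have := st x; rewrite inE xs orbT => /(_ isT).
    rewrite (perm_mem (perm_to_rem at_)) inE => /orP[/eqP xa|//].
    by rewrite -xa xs in na.
  have [t' pt] := IH _ us st'; exists t'.
  by apply: perm_trans (perm_to_rem at_) _; rewrite perm_cons.
by rewrite (perm_big _ pt) /= big_cat /= lerDl sumr_ge0.
Qed.

Section Sums.
Variables (R : realType) (T : choiceType).
Implicit Types (f g : T -> R[i]) (s t : seq T).

(** Duplicate-free lists replace the filter of finite sets, so that estimates are about list sums;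
    [sum_has_sum] identifies the value with the limit behind [csum]. *)
Definition has_sum f (l : R[i]) := forall e : R, 0 < e -> exists s, forall t,
  uniq t -> {subset s <= t} -> cnorm (\sum_(x <- t) f x - l) < e.

(** Absolute summability and a bound on the l^1 norm in one statement; norms are estimated without
    forming a supremum. *)
Definition sumle f (M : R) := forall s, uniq s -> \sum_(x <- s) cnorm (f x) <= M.

Lemma has_sum_unique f l l' : has_sum f l -> has_sum f l' -> l = l'.
Proof.
move=> hl hl'; apply/eqP; rewrite -subr_eq0; apply/eqP/cnorm0_eq0.
apply/eqP; rewrite eq_le cnorm_ge0 andbT; apply/ler_addgt0Pl => e e0.
rewrite addr0; have e2 : 0 < e / 2 by rewrite divr_gt0.
have [s hs] := hl _ e2; have [s' hs'] := hl' _ e2.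
pose t := undup (s ++ s').
have [] : cnorm (\sum_(x <- t) f x - l) < e / 2
   /\ cnorm (\sum_(x <- t) f x - l') < e / 2.
  split; [apply: hs|apply: hs']; rewrite ?undup_uniq // => x xs;
  by rewrite mem_undup mem_cat xs ?orbT.
rewrite cnormBC => h1 h2.
have -> : l - l' = (l - \sum_(x <- t) f x) + (\sum_(x <- t) f x - l').
  by rewrite addrA subrK.
by apply: le_trans (ler_cnormD _ _) _; rewrite (splitr e) lerD // ltW.
Qed.

Lemma has_sum0 : has_sum (fun=> 0) 0.
Proof. by move=> e e0; exists [::] => t _ _; rewrite big1 // subrr cnorm0. Qed.

Lemma has_sumD f g l l' : has_sum f l -> has_sum g l' ->
  has_sum (fun x => f x + g x) (l + l').
Proof.
move=> hl hl' e e0; have e2 : 0 < e / 2 by rewrite divr_gt0.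
have [s hs] := hl _ e2; have [s' hs'] := hl' _ e2.
exists (s ++ s') => t ut st; rewrite big_split /= opprD addrACA.
apply: le_lt_trans (ler_cnormD _ _) _; rewrite (splitr e) ltrD //.
  by apply: hs => // x xs; rewrite st // mem_cat xs.
by apply: hs' => // x xs; rewrite st // mem_cat xs orbT.
Qed.

Lemma has_sumZ c f l : has_sum f l -> has_sum (fun x => c * f x) (c * l).
Proof.
move=> hl e e0; have c0 : 0 < cnorm c + 1 by rewrite ltr_wpDl ?cnorm_ge0.
have [s hs] := hl _ (divr_gt0 e0 c0); exists s => t ut st.
rewrite -mulr_sumr -mulrBr cnormM; have := hs t ut st.
rewrite ltr_pdivlMr // => /le_lt_trans; apply.
by rewrite mulrC ler_wpM2l ?cnorm_ge0 // lerDl.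
Qed.

Lemma has_sumN f l : has_sum f l -> has_sum (fun x => - f x) (- l).
Proof.
by move=> /(has_sumZ (-1)); under eq_fun do rewrite mulN1r; rewrite mulN1r.
Qed.

Lemma has_sumB f g l l' : has_sum f l -> has_sum g l' ->
  has_sum (fun x => f x - g x) (l - l').
Proof. by move=> hl /has_sumN; exact: has_sumD. Qed.

Lemma has_sum_sum (I : Type) (r : seq I) (F : I -> T -> R[i]) (L : I -> R[i]) :
  (forall i, has_sum (F i) (L i)) ->
  has_sum (fun x => \sum_(i <- r) F i x) (\sum_(i <- r) L i).
Proof.
move=> h; elim: r => [|i r IH].
  under eq_fun do rewrite big_nil; rewrite big_nil; exact: has_sum0.
under eq_fun do rewrite big_cons; rewrite big_cons; exact: has_sumD.
Qed.

Lemma has_sum_finite s f : uniq s -> (forall x, x \notin s -> f x = 0) ->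
  has_sum f (\sum_(x <- s) f x).
Proof.
move=> us f0 e e0; exists s => t ut st.
rewrite [X in X - _](bigID (mem s)) /= [X in _ + X - _]big1 // addr0.
rewrite -big_filter (perm_big s) ?subrr ?cnorm0 //.
apply: uniq_perm; rewrite ?filter_uniq // => x; rewrite mem_filter.
by have [/st->|] := boolP (x \in s).
Qed.

Lemma sumle_ge0 f M : sumle f M -> 0 <= M.
Proof. by move=> /(_ [::] isT); rewrite big_nil. Qed.

Lemma sumle_point f M x : sumle f M -> cnorm (f x) <= M.
Proof. by move=> /(_ [:: x] isT); rewrite big_seq1. Qed.

Lemma sumle_le f g M : (forall x, cnorm (f x) <= cnorm (g x)) ->
  sumle g M -> sumle f M.
Proof. by move=> fg gM s /gM; apply: le_trans; exact: ler_sum. Qed.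

Lemma sumle_weaken f M M' : M <= M' -> sumle f M -> sumle f M'.
Proof. by move=> MM h s /h /le_trans; exact. Qed.

Lemma sumle0 : sumle (fun=> 0) 0.
Proof. by move=> s _; rewrite big1 // => x _; rewrite cnorm0. Qed.

Lemma sumleD f g M M' : sumle f M -> sumle g M' ->
  sumle (fun x => f x + g x) (M + M').
Proof.
move=> hf hg s us; apply: le_trans (lerD (hf s us) (hg s us)).
by rewrite -big_split /= ler_sum // => x _; exact: ler_cnormD.
Qed.

Lemma sumleZ c f M : sumle f M -> sumle (fun x => c * f x) (cnorm c * M).
Proof.
move=> hf s us; under eq_bigr do rewrite cnormM.
by rewrite -mulr_sumr ler_wpM2l ?cnorm_ge0 // hf.
Qed.

Lemma sumleN f M : sumle f M -> sumle (fun x => - f x) M.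
Proof. by apply: sumle_le => x; rewrite cnormN. Qed.

Lemma sumleB f g M M' : sumle f M -> sumle g M' ->
  sumle (fun x => f x - g x) (M + M').
Proof. by move=> hf /sumleN; exact: sumleD. Qed.

Lemma sumle_sum (I : Type) (r : seq I) (F : I -> T -> R[i]) (M : I -> R) :
  (forall i, sumle (F i) (M i)) ->
  sumle (fun x => \sum_(i <- r) F i x) (\sum_(i <- r) M i).
Proof.
move=> h; elim: r => [|i r IH].
  under eq_fun do rewrite big_nil; rewrite big_nil; exact: sumle0.
under eq_fun do rewrite big_cons; rewrite big_cons; exact: sumleD.
Qed.

Lemma has_sum_norm_le f M l : sumle f M -> has_sum f l -> cnorm l <= M.
Proof.
move=> hM hl; apply/ler_addgt0Pl => e /hl [s hs].
have {}hs : cnorm (\sum_(x <- undup s) f x - l) < e.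
  by apply: hs => [|x xs]; rewrite ?undup_uniq // mem_undup.
have -> : l = (l - \sum_(x <- undup s) f x) + \sum_(x <- undup s) f x.
  by rewrite subrK.
apply: le_trans (ler_cnormD _ _) (lerD _ _); first by rewrite cnormBC ltW.
apply: le_trans (ler_cnorm_sum _ _ _) (hM _ _); exact: undup_uniq.
Qed.

(* The phases turn the sum of moduli into the modulus of a single sum. *)
Lemma sum_cnorm_has_sum_le (I : Type) (r : seq I) (F : I -> T -> R[i])
    (L : I -> R[i]) (M : R) : (forall i, has_sum (F i) (L i)) ->
  (forall t, uniq t -> \sum_(i <- r) \sum_(x <- t) cnorm (F i x) <= M) ->
  \sum_(i <- r) cnorm (L i) <= M.
Proof.
move=> hL hM.
have /choice[u hu] : forall i, exists u, cnorm u = 1 /\ u * L i = (cnorm (L i))%:C.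
  by move=> i; have [u u1 u2] := unit_phase (L i); exists u.
have hs : has_sum (fun x => \sum_(i <- r) u i * F i x) (\sum_(i <- r) u i * L i).
  by apply: has_sum_sum => i; exact: has_sumZ.
have : sumle (fun x => \sum_(i <- r) u i * F i x) M.
  move=> t ut; apply: le_trans (hM t ut).
  rewrite exchange_big /=; apply: ler_sum => x _.
  apply: le_trans (ler_cnorm_sum _ _ _) _.
  by apply: ler_sum => i _; rewrite cnormM (hu i).1 mul1r.
move=> /has_sum_norm_le /(_ hs); apply: le_trans.
under [in leRHS]eq_bigr do rewrite (hu _).2.
by rewrite -rmorph_sum cnorm_real ler_norm.
Qed.

Lemma has_sum_ge0_exists (p : T -> R) (M : R) : (forall x, 0 <= p x) ->
  (forall s, uniq s -> \sum_(x <- s) p x <= M) ->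
  exists l, has_sum (fun x => (p x)%:C) l.
Proof.
move=> p0 pM; pose S := [set \sum_(x <- s) p x | s in [set s | uniq s]].
have supS : has_sup S.
  split; first by exists (\sum_(x <- [::]) p x), [::].
  by exists M => _ [s us <-]; exact: pM.
exists (sup S)%:C => e e0.
have [_ [s us <-] hs] := sup_adherent e0 supS.
exists s => t ut st; rewrite -rmorph_sum -rmorphB cnorm_real /= ler0_norm.
  have := le_sum_subset us st p0; lra.
by rewrite subr_le0; apply: ub_le_sup; [case: supS|exists t].
Qed.

Lemma has_sum_real_exists (p : T -> R) (M : R) :
  (forall s, uniq s -> \sum_(x <- s) `|p x| <= M) ->
  exists l, has_sum (fun x => (p x)%:C) l.
Proof.
move=> hM.
have [l hl] := has_sum_ge0_exists (fun x => normr_ge0 (p x)) hM.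
(* [p] is the difference of the nonnegative families |p| + p and |p|. *)
have [|s us|l' hl'] := @has_sum_ge0_exists (fun x => `|p x| + p x) (M + M).
- by move=> x; have := ler_norm (- p x); rewrite normrN; lra.
- apply: le_trans (lerD (hM s us) (hM s us)); rewrite -big_split /=.
  by apply: ler_sum => x _; rewrite lerD2l ler_norm.
exists (l' - l); move: (has_sumB hl' hl); congr has_sum.
by apply/funext => x; rewrite -rmorphB addrAC subrr add0r.
Qed.

Lemma sumle_has_sum f M : sumle f M -> exists l, has_sum f l.
Proof.
move=> hM.
have [|l hl] := @has_sum_real_exists (fun x => complex.Re (f x)) M.
  by move=> s /hM; apply: le_trans; apply: ler_sum => x _; exact: Re_le_cnorm.
have [|l' hl'] := @has_sum_real_exists (fun x => complex.Im (f x)) M.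
  by move=> s /hM; apply: le_trans; apply: ler_sum => x _; exact: Im_le_cnorm.
exists (l + 'i * l'); move: (has_sumD hl (has_sumZ 'i hl')); congr has_sum.
by apply/funext => x; rewrite -complexE.
Qed.

Definition tsum f : R[i] := xget 0 [set l | has_sum f l].

Lemma has_sum_tsum f l : has_sum f l -> tsum f = l.
Proof.
by move=> hl; apply: xget_unique => // l' hl'; exact: has_sum_unique hl' hl.
Qed.

Lemma tsumP f M : sumle f M -> has_sum f (tsum f).
Proof. by move=> /sumle_has_sum[l hl]; rewrite (has_sum_tsum hl). Qed.

Definition l1 f := exists M, sumle f M.

Definition nrm f : R := sup [set \sum_(x <- s) cnorm (f x) | s in [set s | uniq s]].

Lemma sumle_nrm f : l1 f -> sumle f (nrm f).
Proof.
move=> [M hM] s us; apply: ub_le_sup; last by exists s.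
by exists M => _ [t ut <-]; exact: hM.
Qed.

Lemma nrm_le f M : sumle f M -> nrm f <= M.
Proof.
move=> hM; apply: ge_sup; first by exists (\sum_(x <- [::]) cnorm (f x)), [::].
by move=> _ [s us <-]; exact: hM.
Qed.

Lemma nrm_ge0 f : l1 f -> 0 <= nrm f.
Proof. by move=> /sumle_nrm /sumle_ge0. Qed.

End Sums.

Lemma partial_sum_seq (V : zmodType) (T : choiceType) (f : T -> V)
  (A : {fset T}) : summability.partial_sum f A = \sum_(x <- A) f x.
Proof. by rewrite [RHS]big_seq_fsetE. Qed.

Lemma sum_has_sum (R : realType) (T : choiceType) (f : T -> R[i]) (l : R[i]) :
  has_sum f l -> summability.sum (f : T -> R[i]^o) = l.
Proof.
move=> hl; have FF := @summability.totally_filter T.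
apply: (@cvg_lim R[i]^o) => //.
apply/cvgrPdist_lt => e e0.
have [r r0 re] := gt0_realP e0.
have [s hs] := hl r r0.
exists [fset x in s]%fset => //= B sB.
rewrite partial_sum_seq -re distrC cnormE ltcR; apply: hs => [|x xs].
  exact: fset_uniq.
by apply: (fsubsetP sB); rewrite inE.
Qed.

Lemma sumle_inj (R : realType) (T T' : choiceType) (h : T' -> T)
    (f : T -> R[i]) (M : R) : injective h -> sumle f M -> sumle (f \o h) M.
Proof.
move=> hi fM s us; have := fM (map h s); rewrite map_inj_uniq // => /(_ us).
by rewrite big_map.
Qed.

(** * The convolution algebra l^1 and the cubic term *)

Section Convolution.
Variables (R : realType) (G : zmodType).
Implicit Types (f g h : G -> R[i]) (m k : G).

Definition convl f g m : R[i] := tsum (fun k => f k * g (m - k)).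

Lemma sumle_convl_term f g m M M' : sumle f M -> sumle g M' ->
  sumle (fun k => f k * g (m - k)) (M * M').
Proof.
move=> hf hg s us; apply: (@le_trans _ _ (\sum_(x <- s) cnorm (f x) * M')).
  apply: ler_sum => k _; rewrite cnormM ler_wpM2l ?cnorm_ge0 //.
  exact: sumle_point hg.
by rewrite -mulr_suml ler_wpM2r ?hf // (sumle_ge0 hg).
Qed.

Lemma has_sum_convl f g m : l1 f -> l1 g ->
  has_sum (fun k => f k * g (m - k)) (convl f g m).
Proof. by move=> [M hf] [M' hg]; exact: tsumP (sumle_convl_term m hf hg). Qed.

(** Fubini is used for finite lists only: [sum_cnorm_has_sum_le] reduces the infinite inner sums to
    finite ones, and each translate of [g] still has norm at most [M']. *)
Lemma sumle_convl f g M M' : sumle f M -> sumle g M' ->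
  sumle (convl f g) (M * M').
Proof.
move=> hf hg s us.
apply: (sum_cnorm_has_sum_le (T := G) (F := fun m k => f k * g (m - k))).
  by move=> m; apply: has_sum_convl; [exists M|exists M'].
move=> t ut; rewrite exchange_big /=.
apply: (@le_trans _ _ (\sum_(k <- t) cnorm (f k) * M')); last first.
  by rewrite -mulr_suml ler_wpM2r ?hf // (sumle_ge0 hg).
apply: ler_sum => k _; under eq_bigr do rewrite cnormM.
rewrite -mulr_sumr ler_wpM2l ?cnorm_ge0 //.
by apply: (sumle_inj (h := fun m => m - k) (addIr _) hg).
Qed.

Lemma l1_convl f g : l1 f -> l1 g -> l1 (convl f g).
Proof. by move=> [M hf] [M' hg]; exists (M * M'); exact: sumle_convl. Qed.

(** Submultiplicativity up to [c] distributes the weight at m over the arguments k and m - k of the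
    two factors. *)
Lemma sumle_convl_weight (om : G -> R) (c : R) f g M M' : (forall m, 0 <= om m) ->
  0 <= c -> (forall k m, om (k + m) <= c * (om k * om m)) -> l1 f -> l1 g ->
  sumle (fun m => (om m)%:C * f m) M -> sumle (fun m => (om m)%:C * g m) M' ->
  sumle (fun m => (om m)%:C * convl f g m) (c * (M * M')).
Proof.
move=> om0 c0 hom lf lg hf hg s us.
apply: (sum_cnorm_has_sum_le (T := G)
          (F := fun m k => (om m)%:C * (f k * g (m - k)))).
  by move=> m; apply: has_sumZ; exact: has_sum_convl.
move=> t ut; rewrite exchange_big /=.
have hw k (h : G -> R[i]) : cnorm ((om k)%:C * h k) = om k * cnorm (h k).
  by rewrite cnormM cnorm_real ger0_norm.
apply: (@le_trans _ _ (c * \sum_(k <- t) om k * cnorm (f k) * M')); last first.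
  rewrite ler_wpM2l // -mulr_suml ler_wpM2r ?(sumle_ge0 hg) //.
  by have := hf t ut; under eq_bigr do rewrite hw.
rewrite mulr_sumr; apply: ler_sum => k _.
apply: (@le_trans _ _ (c * (om k * cnorm (f k)) *
   \sum_(m <- s) cnorm ((om (m - k))%:C * g (m - k)))).
  rewrite mulr_sumr; apply: ler_sum => m _.
  rewrite hw !cnormM cnorm_real (ger0_norm (om0 m)).
  have := hom k (m - k); rewrite addrC subrK => h.
  apply: le_trans (ler_wpM2r _ h) _; first by rewrite mulr_ge0 ?cnorm_ge0.
  rewrite le_eqVlt; apply/orP; left; apply/eqP; ring.
rewrite -mulrA ler_wpM2l // ler_wpM2l ?mulr_ge0 ?cnorm_ge0 //.
exact: (sumle_inj (h := fun m => m - k) (addIr _) hg).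
Qed.

Lemma convlBl f g h m : l1 f -> l1 g -> l1 h ->
  convl (fun k => f k - g k) h m = convl f h m - convl g h m.
Proof.
move=> hf hg hh; apply: has_sum_tsum.
move: (has_sumB (has_sum_convl m hf hh) (has_sum_convl m hg hh)).
by under eq_fun do rewrite -mulrBl.
Qed.

Lemma convlBr f g h m : l1 f -> l1 g -> l1 h ->
  convl f (fun k => g k - h k) m = convl f g m - convl f h m.
Proof.
move=> hf hg hh; apply: has_sum_tsum.
move: (has_sumB (has_sum_convl m hf hg) (has_sum_convl m hf hh)).
by under eq_fun do rewrite -mulrBr.
Qed.

Lemma convl_suml (r : seq nat) (c : nat -> R[i]) (F : nat -> G -> R[i]) g m :
  (forall i, l1 (F i)) -> l1 g ->
  convl (fun k => \sum_(i <- r) c i * F i k) g m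
  = \sum_(i <- r) c i * convl (F i) g m.
Proof.
move=> hF hg; apply: has_sum_tsum.
have := has_sum_sum r (fun i => has_sumZ (c i) (has_sum_convl m (hF i) hg)).
congr has_sum; apply/funext => k; rewrite mulr_suml; apply: eq_bigr => i _.
by rewrite mulrA.
Qed.

Lemma convl_sumr (r : seq nat) (c : nat -> R[i]) (F : nat -> G -> R[i]) g m :
  (forall i, l1 (F i)) -> l1 g ->
  convl g (fun k => \sum_(i <- r) c i * F i k) m
  = \sum_(i <- r) c i * convl g (F i) m.
Proof.
move=> hF hg; apply: has_sum_tsum.
have := has_sum_sum r (fun i => has_sumZ (c i) (has_sum_convl m hg (hF i))).
congr has_sum; apply/funext => k; rewrite mulr_sumr; apply: eq_bigr => i _.
by rewrite mulrCA.
Qed.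

(* With [refl], the cubic term of the lattice system becomes a double
   convolution; the outer index is m_1 and the inner one m_2. *)
Definition refl f m : R[i] := (f (- m))^*.

Lemma sumle_refl f M : sumle f M -> sumle (refl f) M.
Proof.
move=> hf; apply: (sumle_le (g := f \o -%R)) (sumle_inj oppr_inj hf) => m /=.
by rewrite cnorm_conj.
Qed.

Lemma l1_refl f : l1 f -> l1 (refl f).
Proof. by move=> [M hf]; exists M; exact: sumle_refl. Qed.

Lemma nrm_refl f : l1 f -> nrm (refl f) <= nrm f.
Proof. by move=> /sumle_nrm hf; apply/nrm_le/sumle_refl. Qed.

Definition cubic f : G -> R[i] := convl f (convl (refl f) f).

(** The three factors are exchanged one at a time; each exchange costs [d] times two factors of norm
    at most [M]. *)
Lemma sumle_cubicB f g M d : sumle f M -> sumle g M ->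
  sumle (fun k => f k - g k) d ->
  sumle (fun k => cubic f k - cubic g k) (3 * M ^+ 2 * d).
Proof.
move=> hf hg hd.
have lf : l1 f by exists M. have lg : l1 g by exists M.
have rf := l1_refl lf; have rg := l1_refl lg.
have hrd : sumle (fun k => refl f k - refl g k) d.
  move: (sumle_refl hd); congr sumle; apply/funext => k.
  by rewrite /refl rmorphB.
have -> : 3 * M ^+ 2 * d = d * (M * M) + M * (d * M + M * d) by ring.
have -> : (fun k => cubic f k - cubic g k) = (fun k =>
    convl (fun j => f j - g j) (convl (refl f) f) k
    + convl g (fun j => convl (fun i => refl f i - refl g i) f j
                       + convl (refl g) (fun i => f i - g i) j) k).
  apply/funext => k; rewrite convlBl //; last exact: l1_convl.
  rewrite -[LHS](subrKA (convl g (convl (refl f) f) k)); congr (_ + _).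
  rewrite -convlBr //; [|exact: l1_convl..].
  congr (convl g _ k); apply/funext => j.
  by rewrite convlBl // convlBr // addrA subrK.
apply: sumleD; first exact: sumle_convl hd (sumle_convl (sumle_refl hf) hf).
apply: (sumle_convl hg); apply: sumleD; first exact: sumle_convl hrd hf.
exact: sumle_convl (sumle_refl hg) hd.
Qed.

End Convolution.

(** * Limits of complex sequences through real moduli *)

Section ComplexLimits.
Variable R : realType.
Implicit Types (u v : nat -> R[i]) (l : R[i]).

Definition lim_to u l := cnorm (u k - l) @[k --> \oo] --> (0 : R).

Lemma lim_to_le u l (b : nat -> R) : (forall k, cnorm (u k - l) <= b k) ->
  b @ \oo --> 0 -> lim_to u l.
Proof.
move=> hb b0; apply: (@squeeze_cvgr _ _ _ _ (fun=> 0) b) => //.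
  by apply: nearW => k; rewrite cnorm_ge0 hb.
exact: cvg_cst.
Qed.

Lemma le_lim_bound (a : R) (b : nat -> R) : (forall k, a <= b k) ->
  b @ \oo --> 0 -> a <= 0.
Proof.
move=> ab b0; have <- : limn b = 0 by apply/cvg_lim.
apply: limr_ge; first by apply/cvg_ex; exists 0.
exact: nearW.
Qed.

Lemma lim_to_unique u l l' : lim_to u l -> lim_to u l' -> l = l'.
Proof.
move=> h h'; apply/eqP; rewrite -subr_eq0; apply/eqP/cnorm0_eq0/eqP.
rewrite eq_le cnorm_ge0 andbT.
apply: (@le_lim_bound _ (fun k => cnorm (u k - l) + cnorm (u k - l'))).
  move=> k; rewrite (cnormBC (u k) l).
  by apply: le_trans (ler_cnormD _ _); rewrite addrA subrK.
by rewrite -(addr0 0); exact: cvgD.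
Qed.

Lemma lim_to_cst l : lim_to (fun=> l) l.
Proof.
by apply: (@lim_to_le _ _ (fun=> 0)); rewrite ?subrr ?cnorm0 //; exact: cvg_cst.
Qed.

Lemma lim_toD u v l l' : lim_to u l -> lim_to v l' ->
  lim_to (fun k => u k + v k) (l + l').
Proof.
move=> h h'; apply: (lim_to_le (b := fun k => cnorm (u k - l) + cnorm (v k - l'))).
  by move=> k; rewrite opprD addrACA ler_cnormD.
by rewrite -(addr0 0); exact: cvgD.
Qed.

Lemma lim_toZ c u l : lim_to u l -> lim_to (fun k => c * u k) (c * l).
Proof.
move=> h; apply: (lim_to_le (b := fun k => cnorm c * cnorm (u k - l))).
  by move=> k; rewrite -mulrBr cnormM.
by rewrite -(mulr0 (cnorm c)); apply: cvgM => //; exact: cvg_cst.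
Qed.

Lemma lim_to_conj u l : lim_to u l -> lim_to (fun k => (u k)^*) l^*.
Proof.
by apply: lim_to_le => k; rewrite -rmorphB cnorm_conj.
Qed.

Lemma lim_to_shift u l (N : nat) : lim_to u l -> lim_to (fun k => u (k + N)%N) l.
Proof. by move=> h; rewrite /lim_to (cvg_shiftn N (fun k => cnorm (u k - l))). Qed.

Lemma has_sum_lim_to (f : nat -> R[i]) l : has_sum f l ->
  lim_to (fun k => \sum_(0 <= i < k) f i) l.
Proof.
move=> hl; apply/cvgrPdist_lt => e /hl[s hs].
exists (\max_(i <- s) i.+1)%N => // k /= hk.
rewrite sub0r normrN ger0_norm ?cnorm_ge0 //; apply: hs; first exact: iota_uniq.
move=> i si; rewrite mem_index_iota /=; apply: leq_trans hk.
exact: leq_bigmax_seq.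
Qed.

End ComplexLimits.

(** Fatou's lemma for counting measure: a finite list sees only finitely many pointwise limits. *)
Lemma sumle_lim (R : realType) (T : choiceType) (F : nat -> T -> R[i])
    (f : T -> R[i]) (M : R) : (forall N, sumle (F N) M) ->
  (forall x, lim_to (F^~ x) (f x)) -> sumle f M.
Proof.
move=> hF hl s us; rewrite -subr_le0.
apply: (@le_lim_bound _ _ (fun k => \sum_(x <- s) cnorm (F k x - f x))).
  move=> k; rewrite lerBlDr; apply: le_trans (lerD (lexx _) (hF k s us)).
  rewrite -big_split /=; apply: ler_sum => x _.
  by rewrite (cnormBC (F k x)); apply: le_trans (ler_cnormD _ _); rewrite subrK.
elim: {us}s => [|x s IH].
  by under eq_fun do rewrite big_nil; exact: cvg_cst.
under eq_fun do rewrite big_cons.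
have h := cvgD (hl x : _ --> (0 : R)) IH; rewrite addr0 in h; exact: h.
Qed.

Lemma triangular_sum (V : nmodType) (F : nat -> nat -> V) (N : nat) :
  \sum_(0 <= k < N) \sum_(0 <= i < k.+1) F i (k - i)%N =
  \sum_(0 <= i < N) \sum_(0 <= j < N - i) F i j.
Proof.
elim: N => [|N IH]; first by rewrite !big_geq.
rewrite big_nat_recr //= IH [RHS]big_nat_recr //= subSnn big_nat1.
rewrite [X in _ + X]big_nat_recr //= subnn addrA; congr (_ + _).
rewrite -big_split /= big_nat_cond [RHS]big_nat_cond.
apply: eq_bigr => i; rewrite andbT => /andP[_ iN].
by rewrite subSn ?(ltnW iN) // big_nat_recr.
Qed.

(** * Power series with coefficients in l^1 *)

Section PowerSeries.
Variables (R : realType) (G : zmodType) (e : R).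
Hypothesis e0 : 0 < e.
Implicit Types (x y z : nat -> G -> R[i]) (X Y : G -> R[i]) (M : R).

Definition majsum x (N : nat) : R := \sum_(0 <= i < N) e ^+ i * nrm (x i).

(* [maj x M] makes the power series with coefficients [x] converge in l^1, with
   norm at most [M], at every [eps] with [`|eps| < e]. *)
Definition maj x M := (forall i, l1 (x i)) /\ forall N, majsum x N <= M.

Definition cauchy_prod x y (k : nat) (m : G) : R[i] :=
  \sum_(0 <= i < k.+1) convl (x i) (y (k - i)%N) m.

Lemma majsum_ge0 x N : (forall i, l1 (x i)) -> 0 <= majsum x N.
Proof.
by move=> hx; apply: sumr_ge0 => i _; rewrite mulr_ge0 ?exprn_ge0 ?nrm_ge0 ?ltW.
Qed.

Lemma sumle_cauchy x y k : (forall i, l1 (x i)) -> (forall i, l1 (y i)) ->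
  sumle (cauchy_prod x y k) (\sum_(0 <= i < k.+1) nrm (x i) * nrm (y (k - i)%N)).
Proof.
by move=> hx hy; apply: sumle_sum => i; apply: sumle_convl; exact: sumle_nrm.
Qed.

Lemma l1_cauchy x y k : (forall i, l1 (x i)) -> (forall i, l1 (y i)) ->
  l1 (cauchy_prod x y k).
Proof. by move=> hx hy; eexists; exact: sumle_cauchy. Qed.

(** The pairs of total degree below [N] form a triangle inside the square that the product of the
    two partial sums covers. *)
Lemma majsum_cauchy x y N : (forall i, l1 (x i)) -> (forall i, l1 (y i)) ->
  majsum (cauchy_prod x y) N <= majsum x N * majsum y N.
Proof.
move=> hx hy.
have nx i := nrm_ge0 (hx i); have ny i := nrm_ge0 (hy i).
have ei i : 0 <= e ^+ i by rewrite exprn_ge0 ?ltW.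
apply: (@le_trans _ _ (\sum_(0 <= k < N) \sum_(0 <= i < k.+1)
    (e ^+ i * nrm (x i)) * (e ^+ (k - i) * nrm (y (k - i)%N)))).
  apply: ler_sum => k _.
  apply: le_trans (ler_wpM2l (ei k) (nrm_le (sumle_cauchy k hx hy))) _.
  rewrite mulr_sumr big_nat_cond [leRHS]big_nat_cond; apply: ler_sum => i.
  rewrite andbT ltnS => /andP[_ ik].
  by rewrite mulrACA -exprD subnKC.
rewrite (triangular_sum (fun i j => (e ^+ i * nrm (x i)) * (e ^+ j * nrm (y j)))).
rewrite /majsum mulr_suml; apply: ler_sum => i _; rewrite -mulr_sumr.
rewrite ler_wpM2l ?mulr_ge0 //.
rewrite [leRHS](big_cat_nat (leq0n (N - i)) (leq_subr i N)) /= lerDl.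
by apply: sumr_ge0 => j _; rewrite mulr_ge0.
Qed.

Lemma maj_cauchy x y M M' : maj x M -> maj y M' -> maj (cauchy_prod x y) (M * M').
Proof.
move=> [hx xM] [hy yM]; split=> [k|N]; first exact: l1_cauchy.
apply: le_trans (majsum_cauchy N hx hy) _.
by apply: ler_pM; rewrite ?majsum_ge0.
Qed.

Variable eps : R.
Hypothesis eps_lt : `|eps| < e.
(** Strictly inside the radius [e], a tail from degree N on gains the factor q ^ N, which turns mere
    boundedness of the majorants into a rate of convergence. *)
Let q : R := `|eps| / e.

Let q_ge0 : 0 <= q. Proof. by rewrite divr_ge0 // ltW. Qed.
Let q_lt1 : q < 1. Proof. by rewrite ltr_pdivrMr // mul1r. Qed.

Let cnorm_eps i : cnorm (eps%:C ^+ i) = q ^+ i * e ^+ i.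
Proof. by rewrite cnormX cnorm_real -exprMn divfK // gt_eqF. Qed.

Let cnorm_eps_le N i : (N <= i)%N -> cnorm (eps%:C ^+ i) <= q ^+ N * e ^+ i.
Proof.
move=> Ni; rewrite cnorm_eps ler_wpM2r ?exprn_ge0 ?(ltW e0) //.
by rewrite ler_wiXn2l // ltW.
Qed.

Let cvg_q (c : R) : q ^+ k * c @[k --> \oo] --> 0.
Proof.
rewrite -(mul0r c); apply: cvgM; last exact: cvg_cst.
by apply: cvg_expr; rewrite ger0_norm.
Qed.

Definition psum x (N : nat) (m : G) : R[i] :=
  \sum_(0 <= i < N) eps%:C ^+ i * x i m.

(** Pointwise convergence suffices as a definition: [sumle_pevB] recovers convergence in l^1 from
    the majorant. *)
Definition pev x X := forall m, lim_to (fun N => psum x N m) (X m).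

Lemma sumle_psumB x M N N' : maj x M ->
  sumle (fun m => psum x (N' + N)%N m - psum x N m) (q ^+ N * M).
Proof.
move=> [hx xM]; apply: (@sumle_weaken _ _ _
  (\sum_(N <= i < N' + N) cnorm (eps%:C ^+ i) * nrm (x i))); last first.
  have -> : (fun m => psum x (N' + N)%N m - psum x N m) =
      (fun m => \sum_(N <= i < N' + N) eps%:C ^+ i * x i m).
    apply/funext => m; rewrite /psum (big_cat_nat (leq0n N) (leq_addl N' N)) /=.
    by rewrite addrAC subrr add0r.
  by apply: sumle_sum => i; apply: sumleZ; exact: sumle_nrm.
apply: (@le_trans _ _ (q ^+ N * majsum x (N' + N)%N)); last first.
  by rewrite ler_wpM2l ?exprn_ge0.
rewrite /majsum mulr_sumr (big_cat_nat (leq0n N) (leq_addl N' N)) /=.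
apply: (@le_trans _ _ (\sum_(N <= i < N' + N) q ^+ N * (e ^+ i * nrm (x i)))).
  rewrite big_nat_cond [leRHS]big_nat_cond; apply: ler_sum => i.
  rewrite andbT => /andP[Ni _].
  by rewrite mulrA ler_wpM2r ?nrm_ge0 // cnorm_eps_le.
rewrite lerDr; apply: sumr_ge0 => i _.
by rewrite mulr_ge0 ?exprn_ge0 // mulr_ge0 ?exprn_ge0 ?nrm_ge0 // ltW.
Qed.

Lemma psum0 x m : psum x 0 m = 0.
Proof. by rewrite /psum big_geq. Qed.

Lemma psumS x N m : psum x N.+1 m = x 0%N m + eps%:C * psum (x \o S) N m.
Proof.
rewrite /psum big_nat_recl // expr0 mul1r mulr_sumr; congr (_ + _).
by apply: eq_bigr => i _; rewrite /= exprS mulrA.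
Qed.

Lemma sumle_psum x M N : maj x M -> sumle (psum x N) M.
Proof.
move=> /(sumle_psumB 0 N); rewrite expr0 mul1r addn0; congr sumle.
by apply/funext => m; rewrite psum0 subr0.
Qed.

Lemma has_sum_psum x M m : maj x M ->
  has_sum (fun i => eps%:C ^+ i * x i m) (tsum (fun i => eps%:C ^+ i * x i m)).
Proof.
move=> [hx hM]; apply: (@tsumP _ _ _ M) => s us.
set N := (\max_(i <- s) i.+1)%N; apply: le_trans (hM N).
apply: (@le_trans _ _ (\sum_(i <- s) e ^+ i * nrm (x i))).
  apply: ler_sum => i _; rewrite cnormM ler_pM ?cnorm_ge0 //.
    by apply: le_trans (cnorm_eps_le (leq0n i)) _; rewrite expr0 mul1r.
  by apply: sumle_point; exact: sumle_nrm.
apply: le_sum_subset => // i; last by rewrite mulr_ge0 ?exprn_ge0 ?nrm_ge0 ?ltW.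
by move=> si; rewrite mem_index_iota /= /N; exact: leq_bigmax_seq.
Qed.

Lemma pev_tsum x M : maj x M -> pev x (fun m => tsum (fun i => eps%:C ^+ i * x i m)).
Proof. by move=> xM m; apply/has_sum_lim_to/(has_sum_psum m xM). Qed.

(** The bound between two partial sums is uniform in the larger one, so it passes to the pointwise
    limit. *)
Lemma sumle_pevB x X M N : maj x M -> pev x X ->
  sumle (fun m => X m - psum x N m) (q ^+ N * M).
Proof.
move=> xM hX.
apply: (sumle_lim (F := fun N' m => psum x (N' + N)%N m - psum x N m)).
  by move=> N'; exact: sumle_psumB.
by move=> m; apply: lim_toD (lim_to_shift N (hX m)) (lim_to_cst _).
Qed.

Lemma sumle_pev x X M : maj x M -> pev x X -> sumle X M.
Proof. by move=> xM /sumle_lim; apply=> N; exact: sumle_psum. Qed.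

(* Only products of total degree at least N are lost, and each of them carries
   a factor q ^ N. *)
Lemma convl_psum_cauchy x y M M' N m : maj x M -> maj y M' ->
  cnorm (psum (cauchy_prod x y) N m - convl (psum x N) (psum y N) m)
  <= q ^+ N * (M * M').
Proof.
move=> xM yM; have [hx xM'] := xM; have [hy yM'] := yM.
pose F i j := eps%:C ^+ (i + j) * convl (x i) (y j) m.
have -> : psum (cauchy_prod x y) N m = \sum_(0 <= i < N) \sum_(0 <= j < N - i) F i j.
  rewrite -triangular_sum; apply: eq_bigr => k _; rewrite mulr_sumr.
  rewrite big_nat_cond [RHS]big_nat_cond; apply: eq_bigr => i.
  by rewrite andbT ltnS /F => /andP[_ ik]; rewrite subnKC.
have -> : convl (psum x N) (psum y N) m = \sum_(0 <= i < N) \sum_(0 <= j < N) F i j.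
  rewrite convl_suml //; last by exists M'; exact: sumle_psum.
  apply: eq_bigr => i _; rewrite convl_sumr // mulr_sumr.
  by apply: eq_bigr => j _; rewrite mulrA -exprD.
rewrite cnormBC -sumrB.
under eq_bigr => i _ do
  rewrite (big_cat_nat (leq0n (N - i)) (leq_subr i N)) /= addrAC subrr add0r.
apply: le_trans (ler_cnorm_sum _ _ _) _.
apply: (@le_trans _ _ (q ^+ N * (majsum x N * majsum y N))); last first.
  by rewrite ler_wpM2l ?exprn_ge0 // ler_pM ?majsum_ge0.
rewrite /majsum mulr_suml mulr_sumr big_nat_cond [leRHS]big_nat_cond.
apply: ler_sum => i; rewrite andbT => /andP[_ iN].
apply: le_trans (ler_cnorm_sum _ _ _) _.
rewrite mulr_sumr mulr_sumr.
rewrite [leRHS](big_cat_nat (leq0n (N - i)) (leq_subr i N)) /=.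
rewrite ler_wpDl //.
  apply: sumr_ge0 => j _; rewrite mulr_ge0 ?exprn_ge0 //.
  by rewrite mulr_ge0 ?exprn_ge0 // mulr_ge0 ?exprn_ge0 ?nrm_ge0 // ltW.
rewrite big_nat_cond [leRHS]big_nat_cond; apply: ler_sum => j.
rewrite andbT => /andP[jN _]; rewrite /F cnormM.
have -> : q ^+ N * (e ^+ i * nrm (x i) * (e ^+ j * nrm (y j))) =
    q ^+ N * e ^+ (i + j) * (nrm (x i) * nrm (y j)) by rewrite exprD; ring.
apply: ler_pM; rewrite ?cnorm_ge0 //.
  by apply: cnorm_eps_le; lia.
by apply: sumle_point; apply: sumle_convl; exact: sumle_nrm.
Qed.

Lemma pev_cauchy x y X Y M M' : maj x M -> maj y M' -> pev x X -> pev y Y ->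
  pev (cauchy_prod x y) (convl X Y).
Proof.
move=> xM yM hX hY m.
have sX := sumle_pev xM hX; have sY := sumle_pev yM hY.
have lX : l1 X by exists M. have lY : l1 Y by exists M'.
have lx N : l1 (psum x N) by exists M; exact: sumle_psum.
have ly N : l1 (psum y N) by exists M'; exact: sumle_psum.
(* Three errors of size q ^ N * M * M': truncating the Cauchy product, and replacing each of the two
   limits by its partial sum. *)
apply: (lim_to_le _ (cvg_q (3 * (M * M')))) => N.
have h0 := convl_psum_cauchy N m xM yM.
have h1 : cnorm (convl X Y m - convl (psum x N) Y m) <= q ^+ N * M * M'.
  by rewrite -convlBl //; exact: sumle_point (sumle_convl (sumle_pevB N xM hX) sY).
have h2 : cnorm (convl (psum x N) Y m - convl (psum x N) (psum y N) m)
    <= M * (q ^+ N * M').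
  rewrite -convlBr //.
  exact: sumle_point (sumle_convl (sumle_psum N xM) (sumle_pevB N yM hY)).
have -> : psum (cauchy_prod x y) N m - convl X Y m =
    (psum (cauchy_prod x y) N m - convl (psum x N) (psum y N) m)
    - ((convl X Y m - convl (psum x N) Y m)
       + (convl (psum x N) Y m - convl (psum x N) (psum y N) m)) by ring.
apply: le_trans (ler_cnormB _ _) _.
have := ler_cnormD (convl X Y m - convl (psum x N) Y m)
  (convl (psum x N) Y m - convl (psum x N) (psum y N) m).
move: h0 h1 h2.
have -> : q ^+ N * (3 * (M * M')) = q ^+ N * (M * M') + q ^+ N * M * M'
  + M * (q ^+ N * M') by ring.
lra.
Qed.

Lemma pev_convl x X w M W : maj x M -> pev x X -> sumle w W ->
  pev (fun i => convl (x i) w) (convl X w).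
Proof.
move=> xM hX hw m; have lw : l1 w by exists W.
have lX : l1 X by exists M; exact: sumle_pev hX.
have lx N : l1 (psum x N) by exists M; exact: sumle_psum.
apply: (lim_to_le _ (cvg_q (M * W))) => N.
have -> : psum (fun i => convl (x i) w) N m = convl (psum x N) w m.
  by rewrite convl_suml //; case: xM.
rewrite cnormBC -convlBl // mulrA.
exact: sumle_point (sumle_convl (sumle_pevB N xM hX) hw).
Qed.

Lemma maj_refl x M : maj x M -> maj (fun i => refl (x i)) M.
Proof.
move=> [hx xM]; split=> [i|N]; first exact: l1_refl.
apply: le_trans (xM N); apply: ler_sum => i _.
by rewrite ler_wpM2l ?exprn_ge0 ?nrm_refl ?ltW.
Qed.

(** Here [eps] has to be real: conjugation fixes its powers and acts on the coefficients alone. *)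
Lemma pev_refl x X : pev x X -> pev (fun i => refl (x i)) (refl X).
Proof.
move=> hX m; move: (lim_to_conj (hX (- m))); congr lim_to.
apply/funext => N; rewrite rmorph_sum; apply: eq_bigr => i _.
by rewrite rmorphM rmorphXn; congr (_ ^+ _ * _); rewrite /= oppr0.
Qed.

End PowerSeries.

(** * The fixed-point equation for an abstract bounded multiplier [r] *)

Section LyapunovSchmidt.
Variables (R : realType) (G : zmodType).
Variables (w : G -> R[i]) (Wn Omega sigma : R) (r : G -> R[i]) (rn : R).
Hypothesis w_le : sumle w Wn.
Hypothesis r_le : forall m, cnorm (r m) <= rn.
Implicit Types (x : nat -> G -> R[i]) (X a : G -> R[i]).

Let K : R := `|Omega| + Wn + `|sigma|.

Let lw : l1 w. Proof. by exists Wn. Qed.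
Let Wn0 : 0 <= Wn. Proof. exact: sumle_ge0 w_le. Qed.
Let rn0 : 0 <= rn. Proof. exact: le_trans (cnorm_ge0 (r 0)) (r_le 0). Qed.
Let K0 : 0 <= K. Proof. by rewrite !addr_ge0. Qed.

(* The lattice equations off the resonant set read X = a + eps r (pert X), where
   a is the resonant part of X and r inverts minus the unperturbed operator. *)
Definition pert X m : R[i] :=
  Omega%:C * X m + convl X w m - sigma%:C * cubic X m.

Lemma sumle_pertB X Y M d : sumle X M -> sumle Y M ->
  sumle (fun m => X m - Y m) d ->
  sumle (fun m => pert X m - pert Y m) (K * (1 + 3 * M ^+ 2) * d).
Proof.
move=> hX hY hd; have lX : l1 X by exists M. have lY : l1 Y by exists M.
have -> : (fun m => pert X m - pert Y m) = (fun m =>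
    Omega%:C * (X m - Y m) + convl (fun k => X k - Y k) w m
    - sigma%:C * (cubic X m - cubic Y m)).
  by apply/funext => m; rewrite convlBl // /pert; ring.
apply: (sumle_weaken _ (sumleB (sumleD (sumleZ Omega%:C hd) (sumle_convl hd w_le))
   (sumleZ sigma%:C (sumle_cubicB hX hY hd)))).
rewrite !cnorm_real /K.
have d0 := sumle_ge0 hd.
have M20 : 0 <= 3 * M ^+ 2 * d.
  by apply: mulr_ge0 => //; apply: mulr_ge0 => //; exact: sqr_ge0.
have := mulr_ge0 (normr_ge0 Omega) M20; have := mulr_ge0 Wn0 M20.
have := mulr_ge0 (normr_ge0 sigma) d0.
have -> : `|sigma| * (3 * M ^+ 2 * d) = `|sigma| * M ^+ 2 * d * 3 by ring.
lra.
Qed.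

(** The contraction estimate bounds the norm of the difference by a factor below 1 times itself.
    Existence comes from the series, so no iteration is run. *)
Lemma fixpoint_unique a eps X Y M :
  (forall m, X m = a m + eps%:C * (r m * pert X m)) ->
  (forall m, Y m = a m + eps%:C * (r m * pert Y m)) ->
  sumle X M -> sumle Y M -> `|eps| * (rn * (K * (1 + 3 * M ^+ 2))) < 1 ->
  X = Y.
Proof.
move=> eX eY hX hY heps; pose D m := X m - Y m.
have lD : l1 D by exists (M + M); exact: sumleB.
have hD := sumle_nrm lD.
have : sumle D (`|eps| * (rn * (K * (1 + 3 * M ^+ 2) * nrm D))).
  have DE m : D m = eps%:C * (r m * (pert X m - pert Y m)).
    by rewrite /D eX eY; ring.
  apply: (sumle_le (g := fun m => eps%:C * (r m * (pert X m - pert Y m)))).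
    by move=> m; rewrite DE.
  rewrite -(cnorm_real eps); apply: sumleZ.
  apply: (sumle_le (g := fun m => rn%:C * (pert X m - pert Y m))).
    by move=> m; rewrite !cnormM cnorm_real ger0_norm // ler_wpM2r ?cnorm_ge0.
  rewrite -{2}(ger0_norm rn0) -(cnorm_real rn).
  by apply: sumleZ; exact: sumle_pertB hX hY hD.
move=> /nrm_le; have n0 := nrm_ge0 lD.
have -> : `|eps| * (rn * (K * (1 + 3 * M ^+ 2) * nrm D)) =
  (`|eps| * (rn * (K * (1 + 3 * M ^+ 2)))) * nrm D by ring.
move: heps; set t := `|eps| * _ => t1 hn.
have nD0 : nrm D = 0.
  apply/eqP; rewrite eq_le n0 andbT leNgt; apply/negP => np.
  by move: hn; rewrite leNgt gtr_pMl // t1.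
apply/funext => m; apply/eqP; rewrite -subr_eq0; apply/eqP/cnorm0_eq0/eqP.
by rewrite eq_le cnorm_ge0 andbT -nD0; exact: (sumle_point (f := D)).
Qed.

Definition pert_coef x k m : R[i] :=
  Omega%:C * x k m + convl (x k) w m
  - sigma%:C * cauchy_prod x (cauchy_prod (fun i => refl (x i)) x) k m.

Lemma eq_cauchy_prod x x' y y' k : (forall i, (i <= k)%N -> x i = x' i) ->
  (forall i, (i <= k)%N -> y i = y' i) ->
  cauchy_prod x y k = cauchy_prod x' y' k.
Proof.
move=> hx hy; apply/funext => m; apply: eq_big_nat => i /andP[_].
by rewrite ltnS => ik; rewrite (hx _ ik) (hy _ (leq_subr i k)).
Qed.

(** Causality: degree k of the perturbation sees only degrees up to k, which makes the recursion for
    the solution well founded. *)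
Lemma eq_pert_coef x y k : (forall i, (i <= k)%N -> x i = y i) ->
  pert_coef x k = pert_coef y k.
Proof.
move=> xy; rewrite /pert_coef (xy _ (leqnn k)).
rewrite (@eq_cauchy_prod x y _ (cauchy_prod (fun i => refl (y i)) y) k xy) //.
move=> i ik; apply: eq_cauchy_prod => j ji; rewrite xy //;
  exact: leq_trans ji ik.
Qed.

Lemma pert_coef0 x : pert_coef x 0 = pert (x 0%N).
Proof.
have h y z : cauchy_prod y z 0 = convl (y 0%N) (z 0%N).
  by apply/funext => m; rewrite /cauchy_prod big_nat1.
by rewrite /pert_coef !h.
Qed.

(** Course-of-values recursion: each coefficient needs all earlier ones, so the whole history is
    carried as a function. [hist a k] is correct up to index k and repeats its k-th entry from there
    on. *)
Fixpoint hist a k : nat -> G -> R[i] :=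
  if k is k'.+1 then
    fun i => if (i <= k')%N then hist a k' i
             else fun m => r m * pert_coef (hist a k') k' m
  else fun _ => a.

Definition sol_coef a k : G -> R[i] := hist a k k.

Lemma hist_sol_coef a k i : (i <= k)%N -> hist a k i = sol_coef a i.
Proof.
elim: k => [|k IH]; first by rewrite leqn0 => /eqP->.
rewrite leq_eqVlt => /orP[/eqP-> //|]; rewrite ltnS /= => ik.
by rewrite ik IH.
Qed.

(** Comparison of the coefficients of eps ^ (k + 1) in X = a + eps r (pert X). *)
Lemma sol_coefS a k :
  sol_coef a k.+1 = fun m => r m * pert_coef (sol_coef a) k m.
Proof.
rewrite {1}/sol_coef /= ltnn; apply/funext => m; congr (_ * _).
by rewrite (@eq_pert_coef _ (sol_coef a)) // => i; exact: hist_sol_coef.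
Qed.

Lemma l1_pert_coef x k : (forall i, l1 (x i)) -> l1 (pert_coef x k) /\
  nrm (pert_coef x k) <= `|Omega| * nrm (x k) + nrm (x k) * Wn
   + `|sigma| * nrm (cauchy_prod x (cauchy_prod (fun i => refl (x i)) x) k).
Proof.
move=> hx.
have hc : l1 (cauchy_prod x (cauchy_prod (fun i => refl (x i)) x) k).
  by do 2?apply: l1_cauchy => // ?; exact: l1_refl.
have hs := sumleB (sumleD (sumleZ Omega%:C (sumle_nrm (hx k)))
  (sumle_convl (sumle_nrm (hx k)) w_le)) (sumleZ sigma%:C (sumle_nrm hc)).
move: hs; rewrite !cnorm_real => hs.
by split; [eexists; exact: hs|exact: nrm_le hs].
Qed.

Lemma l1_sol_coef a k : l1 a -> l1 (sol_coef a k).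
Proof.
move=> ha; have [n le_kn] := ubnP k; elim: n k le_kn => // n IH [|k] // kn.
rewrite sol_coefS.
(* [l1_pert_coef] wants every coefficient in l^1, while the induction covers degrees up to k; by
   causality the later ones may be replaced by [a]. *)
pose x i := if (i <= k)%N then sol_coef a i else a.
have [M hM] : l1 (pert_coef x k).
  apply: (proj1 (l1_pert_coef k _)) => i; rewrite /x.
  by case: ifP => // ik; apply: IH; exact: leq_ltn_trans ik kn.
exists (rn * M).
apply: (sumle_le (g := fun m => rn%:C * pert_coef (sol_coef a) k m)).
  by move=> m; rewrite !cnormM cnorm_real ger0_norm // ler_wpM2r ?cnorm_ge0.
rewrite -{2}(ger0_norm rn0) -(cnorm_real rn); apply: sumleZ.
by rewrite (eq_pert_coef (y := x)) // => i ik; rewrite /x ik.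
Qed.

Variable e : R.
Hypothesis e0 : 0 < e.

Lemma majsum_pert_coef x N : (forall i, l1 (x i)) ->
  majsum e (pert_coef x) N <= K * (majsum e x N + majsum e x N ^+ 3).
Proof.
move=> hx; set s := majsum e x N.
have s0 : 0 <= s by exact: majsum_ge0.
have hr i : l1 (refl (x i)) by exact: l1_refl.
have hrx i : l1 (cauchy_prod (fun i => refl (x i)) x i) by exact: l1_cauchy.
pose c := cauchy_prod x (cauchy_prod (fun i => refl (x i)) x).
apply: (@le_trans _ _ (`|Omega| * s + s * Wn + `|sigma| * majsum e c N)).
  rewrite /s /majsum mulr_suml !mulr_sumr -!big_split /=; apply: ler_sum => i _.
  apply: le_trans (ler_wpM2l _ (proj2 (l1_pert_coef i hx))) _.
    by rewrite exprn_ge0 // ltW.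
  by rewrite le_eqVlt; apply/orP; left; apply/eqP; ring.
have hc : majsum e c N <= s ^+ 3.
  apply: le_trans (majsum_cauchy e0 N hx hrx) _.
  rewrite exprS ler_wpM2l //; apply: le_trans (majsum_cauchy e0 N hr hx) _.
  rewrite expr2 ler_wpM2r //; apply: ler_sum => i _.
  by rewrite ler_wpM2l ?nrm_refl // exprn_ge0 // ltW.
apply: (@le_trans _ _ (`|Omega| * s + s * Wn + `|sigma| * s ^+ 3)).
  by rewrite lerD2l ler_wpM2l.
have s30 : 0 <= s ^+ 3 by rewrite exprn_ge0.
have := mulr_ge0 (normr_ge0 Omega) s30; have := mulr_ge0 Wn0 s30.
have := mulr_ge0 (normr_ge0 sigma) s0; rewrite /K; nra.
Qed.

Lemma majsumS x N : majsum e x N.+1 = nrm (x 0%N) + e * majsum e (x \o S) N.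
Proof.
rewrite /majsum big_nat_recl // expr0 mul1r mulr_sumr; congr (_ + _).
by apply: eq_bigr => i _; rewrite /= exprS mulrA.
Qed.

(** * The series solution and the remainder at a fixed amplitude *)

Section FixedAmplitude.
Variables (a : G -> R[i]) (al de : R).
Hypothesis a_le : sumle a al.
Hypothesis al_de : al <= de.
Hypothesis e_small : e * (rn * (K * (2 + 8 * de ^+ 2))) <= 1.

Let al0 : 0 <= al. Proof. exact: sumle_ge0 a_le. Qed.
Let lU k : l1 (sol_coef a k). Proof. by apply: l1_sol_coef; exists al. Qed.

(** In the cube 8 al ^ 3, two factors are bounded by [de] and one is kept: the result is linear in
    [al], with a constant depending on [de] alone. *)
Let cube_bound s : 0 <= s <= 2 * al -> K * (s + s ^+ 3) <= K * (2 + 8 * de ^+ 2) * al.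
Proof.
move=> /andP[s0 s2]; rewrite -mulrA ler_wpM2l //.
have h3 : s ^+ 3 <= (2 * al) ^+ 3 by rewrite lerXn2r ?nnegrE // mulr_ge0.
have h2 : al ^+ 2 * al <= de ^+ 2 * al.
  by rewrite ler_wpM2r // lerXn2r ?nnegrE // (le_trans al0).
have e3 : (2 * al) ^+ 3 = 8 * (al ^+ 2 * al) by ring.
rewrite e3 in h3.
have -> : (2 + 8 * de ^+ 2) * al = 2 * al + 8 * (de ^+ 2 * al) by ring.
lra.
Qed.

(* Majorant method: the partial sums s_N of the norms of the terms satisfy
   s_(N+1) <= al + e rn K (s_N + s_N ^ 3), which preserves s_N <= 2 al. *)
Lemma maj_sol_coef : maj e (sol_coef a) (2 * al).
Proof.
split=> // N; elim: N => [|N IH]; first by rewrite /majsum big_geq // mulr_ge0.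
have s0 : 0 <= majsum e (sol_coef a) N by exact: majsum_ge0.
rewrite majsumS.
have h1 : nrm (sol_coef a 0) <= al by exact: nrm_le.
have h2 : majsum e (sol_coef a \o S) N <= rn * majsum e (pert_coef (sol_coef a)) N.
  rewrite /majsum mulr_sumr; apply: ler_sum => i _ /=.
  rewrite mulrCA ler_wpM2l ?exprn_ge0 ?(ltW e0) // sol_coefS; apply: nrm_le.
  apply: (sumle_le (g := fun m => rn%:C * pert_coef (sol_coef a) i m)).
    by move=> m; rewrite !cnormM cnorm_real ger0_norm // ler_wpM2r ?cnorm_ge0.
  rewrite -{2}(ger0_norm rn0) -(cnorm_real rn); apply: sumleZ.
  by apply: sumle_nrm; exact: (proj1 (l1_pert_coef _ _)).
have h3 := majsum_pert_coef N lU.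
have h4 : K * (majsum e (sol_coef a) N + majsum e (sol_coef a) N ^+ 3)
    <= K * (2 + 8 * de ^+ 2) * al by apply: cube_bound; rewrite s0 IH.
have h5 : e * majsum e (sol_coef a \o S) N
    <= e * (rn * (K * (2 + 8 * de ^+ 2) * al)).
  rewrite ler_wpM2l ?(ltW e0) //; apply: le_trans h2 _; rewrite ler_wpM2l //.
  exact: le_trans h3 h4.
have h6 : e * (rn * (K * (2 + 8 * de ^+ 2) * al)) <= al.
  have -> : e * (rn * (K * (2 + 8 * de ^+ 2) * al)) =
    e * (rn * (K * (2 + 8 * de ^+ 2))) * al by ring.
  by rewrite -[leRHS]mul1r ler_wpM2r.
lra.
Qed.

Lemma maj_pert_sol : maj e (pert_coef (sol_coef a)) (K * (2 + 8 * de ^+ 2) * al).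
Proof.
split=> [i|N]; first exact: (proj1 (l1_pert_coef _ _)).
apply: le_trans (majsum_pert_coef N lU) _; apply: cube_bound.
by rewrite majsum_ge0 //=; case: maj_sol_coef.
Qed.

(* Minus sign: the remainder stands on the right-hand side of the bifurcation
   equations. *)
Definition rem_coef k m : R[i] := - pert_coef (sol_coef a) k.+1 m.

(** Dropping the zeroth coefficient and lowering the degree by one costs a factor 1 / e. *)
Lemma maj_rem_coef : maj e rem_coef (e^-1 * (K * (2 + 8 * de ^+ 2)) * al).
Proof.
have [hl hN] := maj_pert_sol.
have hr i : sumle (rem_coef i) (nrm (pert_coef (sol_coef a) i.+1)).
  by apply: sumleN; exact: sumle_nrm.
split=> [i|N]; first by eexists; exact: hr.
rewrite -mulrA ler_pdivlMl //; apply: le_trans (hN N.+1).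
rewrite majsumS ler_wpDl ?nrm_ge0 // ler_wpM2l ?(ltW e0) //.
apply: ler_sum => i _; rewrite ler_wpM2l ?exprn_ge0 ?(ltW e0) //.
exact: nrm_le.
Qed.

Variable eps : R.
Hypothesis eps_lt : `|eps| < e.

Definition sol m : R[i] := tsum (fun i => eps%:C ^+ i * sol_coef a i m).
Definition remainder m : R[i] := tsum (fun i => eps%:C ^+ i * rem_coef i m).

Let pev_sol : pev eps (sol_coef a) sol.
Proof. exact: pev_tsum e0 _ eps_lt _ _ maj_sol_coef. Qed.

Lemma sumle_sol : sumle sol (2 * al).
Proof. exact: sumle_pev e0 _ eps_lt _ _ _ maj_sol_coef pev_sol. Qed.

Let pev_pert : pev eps (pert_coef (sol_coef a)) (pert sol).
Proof.
have mx := maj_sol_coef; have mr := maj_refl e0 mx.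
have h1 := pev_convl e0 eps_lt mx pev_sol w_le.
have h2 := pev_cauchy e0 eps_lt mr mx (pev_refl pev_sol) pev_sol.
have h3 := pev_cauchy e0 eps_lt mx (maj_cauchy e0 mr mx) pev_sol h2.
move=> m.
have := lim_toD (lim_toD (lim_toZ Omega%:C (pev_sol m)) (h1 m))
  (lim_toZ (- sigma%:C) (h3 m)).
rewrite mulNr; congr lim_to; apply/funext => N.
rewrite /psum !mulr_sumr -!big_split /=; apply: eq_bigr => i _.
by rewrite /pert_coef; ring.
Qed.

(** By [sol_coefS] the equation holds exactly between the partial sum of length N + 1 on the left
    and that of length N on the right; both sides then pass to the limit. *)
Lemma sol_fixpoint m : sol m = a m + eps%:C * (r m * pert sol m).
Proof.
apply: lim_to_unique (lim_to_shift 1 (pev_sol m)) _.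
have := lim_toD (lim_to_cst (a m)) (lim_toZ eps%:C (lim_toZ (r m) (pev_pert m))).
congr lim_to; apply/funext => N; rewrite addn1 psumS; congr (_ + _ * _).
rewrite /psum mulr_sumr; apply: eq_bigr => i _ /=.
by rewrite sol_coefS mulrCA.
Qed.

Lemma sumle_remainder : sumle remainder (e^-1 * (K * (2 + 8 * de ^+ 2)) * al).
Proof.
apply: sumle_pev e0 _ eps_lt _ _ _ maj_rem_coef _.
exact: pev_tsum e0 _ eps_lt _ _ maj_rem_coef.
Qed.

Lemma pert_sol m : pert sol m = pert a m - eps%:C * remainder m.
Proof.
apply: lim_to_unique (lim_to_shift 1 (pev_pert m)) _.
have hr := pev_tsum e0 eps_lt maj_rem_coef m.
have := lim_toD (lim_to_cst (pert a m)) (lim_toZ (- eps%:C) hr).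
rewrite mulNr; congr lim_to; apply/funext => N.
rewrite addn1 psumS pert_coef0 mulNr -mulrN; congr (_ + _ * _).
rewrite /psum -sumrN; apply: eq_bigr => i _ /=.
by rewrite /rem_coef mulrN opprK.
Qed.

(** The correction is of order eps, which later puts the nonresonant part below [rho]. *)
Lemma sumle_sol_sub : sumle (fun m => sol m - a m)
  (`|eps| * (rn * (K * (2 + 8 * de ^+ 2) * al))).
Proof.
have -> : (fun m => sol m - a m) = (fun m => eps%:C * (r m * pert sol m)).
  by apply/funext => m; rewrite {1}sol_fixpoint addrAC subrr add0r.
rewrite -(cnorm_real eps); apply: sumleZ.
apply: (sumle_le (g := fun m => rn%:C * pert sol m)).
  by move=> m; rewrite !cnormM cnorm_real ger0_norm // ler_wpM2r ?cnorm_ge0.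
rewrite -{2}(ger0_norm rn0) -(cnorm_real rn); apply: sumleZ.
exact: sumle_pev e0 _ eps_lt _ _ _ maj_pert_sol pev_pert.
Qed.

End FixedAmplitude.

(** * Regularity in weighted l^1 *)

Section Regularity.
Variables (om : G -> R) (c rc : R).
Hypothesis om_ge1 : forall m, 1 <= om m.
Hypothesis om_refl : forall m, om (- m) = om m.
Hypothesis c0 : 0 <= c.
Hypothesis om_sub : forall k m, om (k + m) <= c * (om k * om m).
Hypothesis r_gain : forall m, om m * cnorm (r m) <= rc.

Definition l1w (p : nat) (f : G -> R[i]) := l1 (fun m => (om m ^+ p)%:C * f m).

Let om0 m : 0 <= om m. Proof. exact: le_trans (om_ge1 m). Qed.

Let l1w0 f : l1w 0 f <-> l1 f.
Proof.
by rewrite /l1w; under eq_fun do rewrite expr0 mul1r.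
Qed.

Lemma l1w_l1 p f : l1w p f -> l1 f.
Proof.
move=> [M hM]; exists M; apply: sumle_le hM => m.
rewrite cnormM cnorm_real ger0_norm ?exprn_ge0 // ler_peMl ?cnorm_ge0 //.
exact: exprn_ege1.
Qed.

Lemma l1w_convl p f g : l1w p f -> l1w p g -> l1w p (convl f g).
Proof.
move=> hf hg; have lf := l1w_l1 hf; have lg := l1w_l1 hg.
have [[M hM] [M' hM']] := (hf, hg); exists (c ^+ p * (M * M')).
apply: (sumle_convl_weight (om := fun m => om m ^+ p)) => //.
- by move=> m; exact: exprn_ge0.
- exact: exprn_ge0.
- by move=> k m; rewrite -!exprMn lerXn2r ?nnegrE // !mulr_ge0.
Qed.

Lemma l1w_refl p f : l1w p f -> l1w p (refl f).
Proof.
move=> [M hM]; exists M; move: (sumle_refl hM); congr sumle.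
apply/funext => m; rewrite /refl rmorphM om_refl; congr (_ * _).
by rewrite /= oppr0.
Qed.

Lemma l1w_pert p X : l1w p w -> l1w p X -> l1w p (pert X).
Proof.
move=> hw hX.
have [M1 h1] := hX; have [M2 h2] := l1w_convl hX hw.
have [M3 h3] := l1w_convl hX (l1w_convl (l1w_refl hX) hX).
have h := sumleB (sumleD (sumleZ Omega%:C h1) h2) (sumleZ sigma%:C h3).
eexists; move: h; congr sumle.
by apply/funext => m; rewrite /pert /cubic; ring.
Qed.

(* Bootstrap: [r] gains one power of the weight, and [pert] loses none. *)
Lemma fixpoint_regular a eps X : l1 X -> (forall p, l1w p w) ->
  (forall p, l1w p a) -> (forall m, X m = a m + eps%:C * (r m * pert X m)) ->
  forall p, l1w p X.
Proof.
move=> lX hw ha eX; elim=> [|p IH]; first exact/l1w0.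
have [M hM] := l1w_pert (hw p) IH; have [M' hM'] := ha p.+1.
have rc0 : 0 <= rc.
  by apply: le_trans (r_gain 0); rewrite mulr_ge0 ?cnorm_ge0.
have h : sumle (fun m => (om m ^+ p.+1)%:C * (r m * pert X m)) (rc * M).
  apply: (sumle_le (g := fun m => rc%:C * ((om m ^+ p)%:C * pert X m))).
    move=> m; rewrite !cnormM !cnorm_real (ger0_norm rc0) !ger0_norm ?exprn_ge0 //.
    have -> : om m ^+ p.+1 * (cnorm (r m) * cnorm (pert X m)) =
      (om m * cnorm (r m)) * (om m ^+ p * cnorm (pert X m)) by rewrite exprS; ring.
    by rewrite ler_wpM2r // mulr_ge0 ?exprn_ge0 ?cnorm_ge0.
  by rewrite -{2}(ger0_norm rc0) -(cnorm_real rc); exact: sumleZ.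
eexists; move: (sumleD hM' (sumleZ eps%:C h)); congr sumle.
by apply/funext => m; rewrite [in RHS]eX; ring.
Qed.

End Regularity.
End LyapunovSchmidt.

(** * Comparison with library limits and sums over subsets of the lattice *)

Lemma lim_to_cvg (R : realType) (u : nat -> R[i]) (l : R[i]) :
  lim_to u l -> (u : nat -> R[i]^o) @ \oo --> (l : R[i]^o).
Proof.
move=> h; apply/cvgrPdist_lt => eps eps0.
have [r r0 re] := gt0_realP eps0.
move/cvgrPdist_lt : h => /(_ r r0); apply: filterS => k.
by rewrite sub0r normrN ger0_norm ?cnorm_ge0 // -re distrC cnormE ltcR.
Qed.

Section CsumTsum.
Variable R : realType.
Implicit Types (D : set Z2) (f U : Z2 -> R[i]).

Definition restr D U m : R[i] := if m \in D then U m else 0.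

Lemma csum_has_sum D f l : has_sum (restr D f) l -> csum D f = l.
Proof. exact: sum_has_sum. Qed.

Lemma esum_le D (f : Z2 -> R) (M : R) :
  (forall s, uniq s -> (forall m, m \in s -> D m) -> \sum_(m <- s) f m <= M) ->
  (\esum_(m in D) (f m)%:E <= M%:E)%E.
Proof.
move=> h; apply: ge_ereal_sup => _ [A [fA AD] <-].
rewrite fsbig_finite //= sumEFin lee_fin; apply: h; first exact: fset_uniq.
by move=> m; rewrite in_fset_set // inE => /AD.
Qed.

Lemma sum_le_esum D (f : Z2 -> R) (s : seq Z2) : (forall m, 0 <= f m) ->
  uniq s -> (forall m, m \in s -> D m) ->
  ((\sum_(m <- s) f m)%:E <= \esum_(m in D) (f m)%:E)%E.
Proof.
move=> f0 us sD; apply: esum_ge; exists [set` s].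
  by split; [exact: finite_seq|move=> m /= /sD].
by rewrite -fsbig_seq // sumEFin.
Qed.

Lemma esum_lt_sum D (f : Z2 -> R) (M : R) : (forall m, 0 <= f m) ->
  (\esum_(m in D) (f m)%:E < M%:E)%E ->
  forall s, uniq s -> \sum_(m <- s) (if m \in D then f m else 0) <= M.
Proof.
move=> f0 h s us; rewrite -big_mkcond -big_filter -lee_fin.
apply: le_trans (ltW h); apply: sum_le_esum => //; first exact: filter_uniq.
by move=> m; rewrite mem_filter => /andP[/set_mem].
Qed.

End CsumTsum.

Lemma sumle_finite (R : realType) (T : choiceType) (f : T -> R[i]) (s : seq T) :
  uniq s -> (forall x, x \notin s -> f x = 0) ->
  sumle f (\sum_(x <- s) cnorm (f x)).
Proof.
move=> us f0 t ut; rewrite (bigID (mem s)) /= [X in _ + X]big1 ?addr0.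
  rewrite -big_filter; apply: le_sum_subset; rewrite ?filter_uniq //.
    by move=> x; rewrite mem_filter => /andP[].
  by move=> x; exact: cnorm_ge0.
by move=> x /f0->; rewrite cnorm0.
Qed.

Lemma restr_pick (R : realType) D (U : Z2 -> R[i]) m :
  m \in D -> restr D U m = U m.
Proof. by rewrite /restr => ->. Qed.

(** * The weight 1 + |m|^2 on the integer lattice *)

Section Weight.
Variable R : realType.
Implicit Types (m k : Z2).

(** Equivalent to 1 + |m|^2 / 4 up to a factor 4, but integer-valued, so that its inequalities are
    arithmetic in [int]. *)
Definition wt m : R := (1 + normsq m)%:~R.

Lemma normsq_ge0 m : 0 <= normsq m.
Proof. by rewrite /normsq addr_ge0 ?sqr_ge0. Qed.

Lemma wt_ge1 m : 1 <= wt m.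
Proof. by rewrite /wt -[leLHS]/(1%:~R) ler_int lerDl normsq_ge0. Qed.

Lemma wtN m : wt (- m) = wt m.
Proof. by rewrite /wt /normsq /= !sqrrN. Qed.

(** By the parallelogram law |k + m|^2 <= 2 |k|^2 + 2 |m|^2. *)
Lemma wtD k m : wt (k + m) <= 2 * (wt k * wt m).
Proof.
rewrite /wt -intrM -[2]/(2%:~R) -intrM ler_int /normsq /=.
case: k m => [a b] [c d] /=.
have := sqr_ge0 (a - c); have := sqr_ge0 (b - d).
have := sqr_ge0 (a * c); have := sqr_ge0 (a * d).
have := sqr_ge0 (b * c); have := sqr_ge0 (b * d).
nra.
Qed.

Lemma normsq_real_ge0 m : 0 <= (normsq m)%:~R :> R.
Proof. by rewrite -[leLHS]/(0%:~R) ler_int normsq_ge0. Qed.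

Lemma sum_inv_sqr (N : nat) :
  \sum_(0 <= i < N) (1 + i%:R ^+ 2 : R)^-1 <= 4 - 4 * (N%:R + 1)^-1.
Proof.
elim: N => [|N IH]; first by rewrite big_geq // add0r invr1 mulr1 subrr.
rewrite big_nat_recr //= -(natr1 N); have N0 : 0 <= N%:R :> R by [].
(* The bound telescopes because (N + 1)(N + 2) <= 4 (1 + N^2). *)
have h : (1 + N%:R ^+ 2 : R)^-1 <=
    4 * (N%:R + 1)^-1 - 4 * (N%:R + 1 + 1)^-1.
  rewrite -mulrBr.
  have -> : (N%:R + 1)^-1 - (N%:R + 1 + 1)^-1 =
      ((N%:R + 1) * (N%:R + 1 + 1))^-1 :> R.
    by field; apply/andP; split; rewrite gt_eqF //; lra.
  have p1 : 0 < 1 + N%:R ^+ 2 :> R by rewrite ltr_pwDl // sqr_ge0.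
  have p2 : 0 < (N%:R + 1) * (N%:R + 1 + 1) :> R by apply: mulr_gt0; lra.
  rewrite -(ler_pM2l p1) mulfV ?gt_eqF // mulrCA mulrA ler_pdivlMr //; nra.
lra.
Qed.

Lemma sum_inv_sqr_int (s : seq int) : uniq s ->
  \sum_(x <- s) (1 + (x ^+ 2)%:~R : R)^-1 <= 8.
Proof.
move=> us; pose N := (\max_(x <- s) `|x|.+1)%N.
pose t := map Posz (iota 0 N) ++ map Negz (iota 0 N).
have st : {subset s <= t}.
  move=> x xs; have : (`|x| < N)%N by apply: leq_bigmax_seq.
  rewrite mem_cat; case: x {xs} => k /= kN.
    by rewrite map_f // mem_iota.
  by rewrite orbC map_f // mem_iota /= add0n ltnW.
apply: le_trans (le_sum_subset us st _) _.
  by move=> x; rewrite invr_ge0 addr_ge0 // -[leLHS]/(0%:~R) ler_int sqr_ge0.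
rewrite big_cat /= !big_map.
have hN : 0 <= 4 * (N%:R + 1 : R)^-1 by rewrite mulr_ge0 // invr_ge0 addr_ge0.
have h1 : \sum_(j <- iota 0 N) (1 + (Posz j ^+ 2)%:~R : R)^-1 <= 4.
  apply: (@le_trans _ _ (4 - 4 * (N%:R + 1)^-1)); last by rewrite gerBl.
  apply: le_trans (sum_inv_sqr N); rewrite /index_iota subn0.
  by apply: ler_sum => j _; rewrite rmorphXn.
(* [Negz j] is -(j + 1), so its term is at most the term of j. *)
have h2 : \sum_(j <- iota 0 N) (1 + (Negz j ^+ 2)%:~R : R)^-1 <= 4.
  apply: (@le_trans _ _ (4 - 4 * (N%:R + 1)^-1)); last by rewrite gerBl.
  apply: le_trans (sum_inv_sqr N); rewrite /index_iota subn0.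
  apply: ler_sum => j _; rewrite NegzE sqrrN rmorphXn /=.
  rewrite lef_pV2 ?posrE ?ltr_pwDl ?sqr_ge0 // lerD2l.
  by rewrite lerXn2r ?nnegrE // ler_nat.
lra.
Qed.

(** (1 + x^2 + y^2)^2 dominates (1 + x^2)(1 + y^2), and over a box containing [s] the product splits
    into two one-dimensional sums, each at most 8. *)
Lemma sum_wt_inv2 (s : seq Z2) : uniq s -> \sum_(m <- s) (wt m ^+ 2)^-1 <= 64.
Proof.
move=> us; pose F (x : int) : R := (1 + (x ^+ 2)%:~R)^-1.
have x0 (x : int) : 0 <= (x ^+ 2)%:~R :> R by rewrite -[leLHS]/(0%:~R) ler_int sqr_ge0.
have F0 x : 0 <= F x by rewrite invr_ge0 addr_ge0.
apply: (@le_trans _ _ (\sum_(m <- s) F m.1 * F m.2)).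
  apply: ler_sum => m _; rewrite /F -invfM lef_pV2 ?posrE.
  - rewrite /wt /normsq !rmorphD /= expr2.
    have := x0 m.1; have := x0 m.2; set a := (_ ^+ 2)%:~R; set b := (_ ^+ 2)%:~R.
    nra.
  - by rewrite exprn_gt0 // (lt_le_trans ltr01 (wt_ge1 m)).
  - by rewrite mulr_gt0 // ltr_pwDl.
pose s1 := undup (map fst s); pose s2 := undup (map snd s).
have h1 := sum_inv_sqr_int (undup_uniq (map fst s)).
have h2 := sum_inv_sqr_int (undup_uniq (map snd s)).
have sub : {subset s <= [seq (x, y) | x <- s1, y <- s2]}.
  move=> [x y] h; apply/allpairsP; exists (x, y); split=> //; rewrite mem_undup.
    by apply/mapP; exists (x, y).
  by apply/mapP; exists (x, y).
apply: le_trans (le_sum_subset us sub _) _.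
  by move=> m; exact: mulr_ge0.
rewrite big_allpairs /=; under eq_bigr do rewrite -mulr_sumr.
rewrite -mulr_suml (_ : 64 = 8 * 8); last by ring.
by apply: ler_pM => //; apply: sumr_ge0.
Qed.

End Weight.

(** * Passage between l^2_s and weighted l^1 *)

Section WeightedSummability.
Variable R : realType.
Implicit Types (D : set Z2) (U : Z2 -> R[i]).

(* Cauchy-Schwarz against the summable family [wt ^ -2]. *)
Lemma l2s_l1w (w : Z2 -> R[i]) p : l2s (sublattice (0, 0)%N) (2 * p + 2)%:R w ->
  l1w (@wt R) p (restr (sublattice (0, 0)%N) w).
Proof.
set E := sublattice _; rewrite /l2s => hw.
pose s : R := (2 * p + 2)%:R.
pose F m : R := (1 + (normsq m)%:~R / 4) `^ s * cnorm (w m) ^+ 2.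
have F0 m : 0 <= F m by rewrite mulr_ge0 ?powR_ge0 ?sqr_ge0.
have [M hM] : exists M : R, (\esum_(m in E) (F m)%:E < M%:E)%E.
  have e0 : (0 <= \esum_(m in E) (F m)%:E)%E by apply: esum_ge0 => m _; rewrite lee_fin.
  exists (fine (\esum_(m in E) (F m)%:E) + 1).
  by rewrite EFinD fineK ?ge0_fin_numE // lteDl // ?lte01 // ge0_fin_numE.
(* Cost of exchanging the weights: 1 + |m|^2 <= 4 (1 + |m|^2 / 4), to the power 2 p + 2. *)
pose c : R := 4 ^+ (2 * p + 2).
exists (c * M + 64) => t ut.
have h1 := esum_lt_sum F0 hM ut.
have h2 := sum_wt_inv2 R ut.
apply: (@le_trans _ _ (\sum_(m <- t) (c * (if m \in E then F m else 0)
    + (wt R m ^+ 2)^-1))); last first.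
  by rewrite big_split /= -mulr_sumr lerD // ler_wpM2l // exprn_ge0.
apply: ler_sum => m _; rewrite /restr; case: ifP => [mE|_]; last first.
  by rewrite mulr0 cnorm0 mulr0 add0r invr_ge0 exprn_ge0 // (le_trans ler01) ?wt_ge1.
have w1 := wt_ge1 R m; have w0 : 0 < wt R m by exact: lt_le_trans w1.
rewrite cnormM cnorm_real ger0_norm ?exprn_ge0 ?(ltW w0) //.
set y := wt R m in w1 w0 *; set z := cnorm (w m).
have z0 : 0 <= z by exact: cnorm_ge0.
have hF : (y ^+ (p + 1) * z) ^+ 2 <= c * F m.
  rewrite /F powR_mulrn; last first.
    by rewrite addr_ge0 // divr_ge0 // normsq_real_ge0.
  rewrite [leLHS]exprMn -/z mulrA ler_wpM2r ?sqr_ge0 // /c -exprMn.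
  rewrite -exprM (_ : ((p + 1) * 2 = 2 * p + 2)%N); last by lia.
  apply: lerXn2r; rewrite ?nnegrE ?(ltW w0) //.
    by rewrite mulr_ge0 // addr_ge0 // divr_ge0 // normsq_real_ge0.
  rewrite mulrDr mulrCA divff // !mulr1 /y /wt (intrD _ 1) lerD2r.
  by rewrite ler1n.
apply: le_trans (lerD hF (lexx _)).
(* The extra power of [y] pays for the summable factor, through A B <= A^2 + B^2 with B = y^-1. *)
have -> : y ^+ p * z = (y ^+ (p + 1) * z) * y^-1.
  by rewrite exprD expr1 mulrAC mulfK ?gt_eqF.
rewrite -exprVn; set A := _ * z; set B := y^-1.
have := sqr_ge0 (A - B); have := sqr_ge0 (A + B).
rewrite !expr2; nra.
Qed.

(** Each entry is at most the l^1 bound M, so the squares sum to at most M * M; the real exponent s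
    is rounded up to a natural one. *)
Lemma l1w_l2s D U s : (forall p, l1w (@wt R) p (restr D U)) -> l2s D s U.
Proof.
move=> hU; pose p := Num.bound (Num.max 0 s).
have sp : s <= p%:R.
  apply: (@le_trans _ _ (Num.max 0 s)); first by rewrite le_max lexx orbT.
  by apply/ltW/archi_boundP; rewrite le_max lexx.
have [M hM] := hU p; have M0 := sumle_ge0 hM.
apply: (@le_lt_trans _ _ (M * M)%:E); last exact: ltry.
apply: esum_le => t ut tD.
apply: (@le_trans _ _ (\sum_(m <- t) M * cnorm ((wt R m ^+ p)%:C * restr D U m))).
  rewrite big_seq_cond [leRHS]big_seq_cond; apply: ler_sum => m.
  rewrite andbT => /tD mD.
  apply: (@le_trans _ _ (cnorm ((wt R m ^+ p)%:C * restr D U m) ^+ 2)).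
    rewrite restr_pick ?inE // cnormM exprMn ler_wpM2r ?sqr_ge0 //.
    have w1 := wt_ge1 R m.
    rewrite cnorm_real ger0_norm ?exprn_ge0 ?(le_trans ler01) //.
    have n0 := normsq_real_ge0 R m.
    have b1 : 1 <= 1 + (normsq m)%:~R / 4 :> R by rewrite lerDl divr_ge0.
    apply: le_trans (ler_powR b1 sp) _.
    rewrite powR_mulrn ?(le_trans ler01) //.
    apply: (@le_trans _ _ (wt R m ^+ p)).
      apply: lerXn2r; rewrite ?nnegrE ?(le_trans ler01) //.
      by rewrite /wt (intrD _ 1) lerD2l ler_pdivrMr // ler_peMr // ler1n.
    by rewrite expr2 ler_peMl ?exprn_ege1 // exprn_ge0 // (le_trans ler01).
  by rewrite expr2 ler_wpM2r ?cnorm_ge0 //; exact: sumle_point hM.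
by rewrite -mulr_sumr ler_wpM2l // hM.
Qed.

End WeightedSummability.

Lemma tsum_finite (R : realType) (T : choiceType) (f : T -> R[i]) (s : seq T) :
  uniq s -> (forall x, x \notin s -> f x = 0) -> tsum f = \sum_(x <- s) f x.
Proof. by move=> us f0; exact/has_sum_tsum/has_sum_finite. Qed.

(** * The lattice system as a fixed-point equation *)

Section Lattice.
Variables (R : realType) (w : Z2 -> R[i]) (sigma Omega : R) (n : nat * nat).

Notation E := (sublattice (0, 0)%N).
Notation L := (sublattice n).

Lemma in_sublattice (q : nat * nat) (m : Z2) :
  (m \in sublattice q) = (m.1 == (natZ2 q).1 %[mod 2])%Z &&
                         (m.2 == (natZ2 q).2 %[mod 2])%Z.
Proof.
apply/idP/andP => [/set_mem[/eqP-> /eqP->] //|[/eqP h1 /eqP h2]].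
by apply/mem_set.
Qed.

Lemma sublatticeN (m : Z2) : (- m \in L) = (m \in L).
Proof.
rewrite !in_sublattice /=; congr (_ && _); apply/eqP/eqP; lia.
Qed.

Lemma sublatticeB_even (m k : Z2) : m \in L -> (m - k \in E) = (k \in L).
Proof.
rewrite !in_sublattice /= => /andP[/eqP h1 /eqP h2].
by congr (_ && _); apply/eqP/eqP; lia.
Qed.

Lemma sublatticeD3 (m k j : Z2) : m \in L -> k \in L ->
  (m - k - j \in L) = (j \in L).
Proof.
rewrite !in_sublattice /= => /andP[/eqP h1 /eqP h2] /andP[/eqP h3 /eqP h4].
by congr (_ && _); apply/eqP/eqP; lia.
Qed.

Lemma Sn_sublattice m : m \in Sn n -> m \in L.
Proof. by rewrite in_Sn => /set_mem[h _]; apply/mem_set. Qed.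

Lemma Sn_normsq m : m \in L -> (m \in Sn n) = (normsq m == normsq (natZ2 n)).
Proof.
move=> /set_mem mL; rewrite in_Sn; apply/idP/eqP => [/set_mem[] //|h].
exact/mem_set.
Qed.

Definition lam (m : Z2) : R := ((normsq (natZ2 n))%:~R - (normsq m)%:~R) / 4.

(** The value 0 on S_n and off the sublattice makes the fixed-point equation itself prescribe the
    resonant part and the support. *)
Definition resolvent (m : Z2) : R[i] :=
  if (m \in L) && (m \notin Sn n) then - ((lam m)^-1)%:C else 0.

(** No small divisors occur: |n|^2 and |m|^2 are distinct integers, hence at least 1 apart. The
    second bound is the gain of two derivatives. *)
Lemma lam_ge (m : Z2) : m \in L -> m \notin Sn n ->
  1 <= 4 * `|lam m| /\ wt R m <= 4 * (normsq (natZ2 n) + 2)%:~R * `|lam m|.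
Proof.
move=> mL; rewrite Sn_normsq // => nS.
have hl : 4 * `|lam m| = (`|normsq (natZ2 n) - normsq m|)%:~R.
  have n4 : `|4^-1 : R| = 4^-1 by rewrite ger0_norm // invr_ge0.
  by rewrite /lam normrM -rmorphB intr_norm n4 mulrC divfK.
rewrite mulrAC hl [(_ : R) * _]mulrC -intrM.
rewrite -[1]/(1%:~R) /wt !ler_int.
have := normsq_ge0 m; have := normsq_ge0 (natZ2 n); move: nS.
move: (normsq m) (normsq (natZ2 n)) => x y /eqP xy y0 x0.
by split; nia.
Qed.

Lemma resolvent_le (m : Z2) : cnorm (resolvent m) <= 4.
Proof.
rewrite /resolvent; case: ifP => [/andP[mL mS]|_]; last by rewrite cnorm0.
have [h _] := lam_ge mL mS; rewrite cnormN cnorm_real normfV.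
have l0 : 0 < `|lam m| by lra.
by rewrite -[leLHS]mul1r ler_pdivrMr.
Qed.

Lemma wt_resolvent_le (m : Z2) :
  wt R m * cnorm (resolvent m) <= 4 * (normsq (natZ2 n) + 2)%:~R.
Proof.
rewrite /resolvent; case: ifP => [/andP[mL mS]|_]; last first.
  by rewrite cnorm0 mulr0 mulr_ge0 // -[leLHS]/(0%:~R) ler_int addr_ge0 ?normsq_ge0.
have [h1 h2] := lam_ge mL mS; rewrite cnormN cnorm_real normfV.
have l0 : 0 < `|lam m| by lra.
by rewrite ler_pdivrMr.
Qed.

Hypothesis lw : l1 (restr E w).

Lemma csum_convl U m : m \in L -> l1 (restr L U) ->
  csum L (fun m1 => w (m - m1) * U m1) = convl (restr L U) (restr E w) m.
Proof.
move=> mL lU; apply: csum_has_sum; move: (has_sum_convl m lU lw).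
congr has_sum; apply/funext => k; rewrite /restr sublatticeB_even //.
by case: ifP; rewrite ?mul0r // mulrC.
Qed.

Lemma csum_cubic U m : m \in L -> l1 (restr L U) ->
  csum L (fun m1 => csum L (fun m2 => U m1 * (U (- m2))^* * U (m - m1 - m2)))
  = @cubic R _ (restr L U) m.
Proof.
move=> mL lU; have lr := l1_refl lU; apply: csum_has_sum.
move: (has_sum_convl m lU (l1_convl lr lU)).
congr has_sum; apply/funext => k.
have rk f : restr L f k = if k \in L then f k else 0 by [].
rewrite !rk; case: ifP => kL; last by rewrite mul0r.
symmetry; apply: csum_has_sum; move: (has_sumZ (U k) (has_sum_convl (m - k) lr lU)).
congr has_sum; apply/funext => j; rewrite /refl /restr sublatticeN sublatticeD3 //.
by case: ifP; rewrite ?mulr0 // mulrA.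
Qed.

Lemma lattice_defectE eps U m : m \in L -> l1 (restr L U) ->
  lattice_defect w sigma ((normsq (natZ2 n))%:~R / 4 + eps * Omega) eps n U m
  = (lam m)%:C * U m + eps%:C * pert (restr E w) Omega sigma (restr L U) m.
Proof.
move=> mL lU; rewrite /lattice_defect csum_convl // csum_cubic // /pert restr_pick //.
have -> : (normsq (natZ2 n))%:~R / 4 + eps * Omega - (normsq m)%:~R / 4
  = lam m + eps * Omega by rewrite /lam; field.
by rewrite (rmorphD _ (lam m)) (rmorphM _ eps); ring.
Qed.

Implicit Types a : 'rV[R[i]]_(dS n).

Definition ext a (m : Z2) : R[i] := if m \in Sn n then coef a m else 0.

Definition mode (j : 'I_(dS n)) : Z2 := nth 0 (Sn n) j.

Lemma mode_in j : mode j \in Sn n.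
Proof. by apply: mem_nth; exact: (ltn_ord j). Qed.

Lemma coef_mode a j : coef a (mode j) = a 0 j.
Proof.
by rewrite /coef /mode (index_uniq _ (ltn_ord j)) ?fset_uniq // valK.
Qed.

Lemma in_mode m : m \in Sn n -> exists j, m = mode j.
Proof.
move=> mS; have h : (index m (Sn n) < dS n)%N by rewrite index_mem.
by exists (Ordinal h); rewrite /mode /= nth_index.
Qed.

Lemma sum_mode (F : Z2 -> R) : \sum_(m <- Sn n) F m = \sum_(j < dS n) F (mode j).
Proof. by rewrite (big_nth 0) big_mkord. Qed.

Lemma l1normE a : l1norm a = \sum_(m <- Sn n) cnorm (coef a m).
Proof. by rewrite sum_mode; apply: eq_bigr => j _; rewrite coef_mode. Qed.

Lemma sumle_ext a : sumle (ext a) (l1norm a).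
Proof.
have h := @sumle_finite _ _ (ext a) (Sn n) (fset_uniq _).
move: h; rewrite (_ : \sum_(x <- Sn n) _ = l1norm a); last first.
  by rewrite l1normE; apply: eq_big_seq => m mS; rewrite /ext mS.
by apply=> m; rewrite /ext => /negbTE->.
Qed.

Lemma l1w_ext p a : l1w (@wt R) p (ext a).
Proof.
eexists; apply: (@sumle_finite _ _ _ (Sn n)); first exact: fset_uniq.
by move=> m; rewrite /ext => /negbTE->; rewrite mulr0.
Qed.

(** On a sequence supported in S_n the convolutions collapse to finite sums, so the zeroth
    coefficient of the perturbation is the bifurcation function. *)
Lemma bif_lhsE a m : m \in Sn n ->
  bif_lhs w sigma Omega a m = pert (restr E w) Omega sigma (ext a) m.
Proof.
move=> mS; have mL := Sn_sublattice mS.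
have ext0 k : k \notin Sn n -> ext a k = 0 by rewrite /ext => /negbTE->.
have fS := fset_uniq (Sn n).
rewrite /bif_lhs /pert {1}/ext mS; congr (_ + _ - _ * _).
  rewrite /convl (tsum_finite fS) => [|k /ext0->]; last by rewrite mul0r.
  apply: eq_big_seq => k kS; rewrite /ext kS restr_pick; first by rewrite mulrC.
  by rewrite sublatticeB_even // Sn_sublattice.
have hq q : convl (refl (ext a)) (ext a) q =
    \sum_(k <- Sn n | q + k \in Sn n) (coef a k)^* * coef a (q + k).
  (* [refl (ext a)] is supported on - S_n; summing over opposites makes k = - m_2 the index. *)
  have fN : uniq (map -%R (Sn n)) by rewrite map_inj_uniq //; exact: oppr_inj.
  rewrite /convl (tsum_finite fN) => [|k kS]; last first.
    rewrite /refl ext0 ?conjc0 ?mul0r //.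
    by apply: contra kS => kS; rewrite -(opprK k) map_f.
  rewrite big_map [RHS]big_mkcond /=; apply: eq_big_seq => k kS.
  by rewrite /refl /ext !opprK kS; case: ifP; rewrite ?mulr0.
rewrite /cubic {1}/convl (tsum_finite fS) => [|k /ext0->]; last by rewrite mul0r.
apply: eq_big_seq => k kS; rewrite hq {1}/ext kS mulr_sumr.
by apply: eq_bigr => j _; rewrite mulrA.
Qed.

Lemma fixpoint_lattice eps a (V : Z2 -> R[i]) :
  (forall m, V m = ext a m +
     eps%:C * (resolvent m * pert (restr E w) Omega sigma V m)) <->
  [/\ forall m, m \notin L -> V m = 0, forall m, m \in Sn n -> V m = coef a m &
      forall m, m \in L -> m \notin Sn n ->
        (lam m)%:C * V m + eps%:C * pert (restr E w) Omega sigma V m = 0].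
Proof.
have lam0 m : m \in L -> m \notin Sn n -> (lam m)%:C != 0 :> R[i].
  move=> mL mS; have [h _] := lam_ge mL mS.
  apply/eqP => /complexI l0; move: h; rewrite l0 normr0 mulr0.
  by rewrite ler10.
split=> [hV|[h0 hS hL] m].
  split=> m.
  - move=> mL; rewrite hV /ext /resolvent (negbTE mL) mul0r mulr0 addr0.
    by case: ifP => // /Sn_sublattice; rewrite (negbTE mL).
  - by move=> mS; rewrite hV /ext /resolvent mS andbF mul0r mulr0 addr0.
  - move=> mL mS; rewrite [V m in X in X + _]hV /ext /resolvent.
    rewrite mL mS (negbTE mS) add0r /=.
    rewrite mulNr mulrN mulrN rmorphV ?unitfE; last first.
      by apply: contra (lam0 m mL mS) => /eqP->.
    by rewrite mulrCA mulVKf ?lam0 // addNr.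
rewrite /ext /resolvent; have [mS|mS] := boolP (m \in Sn n).
  by rewrite andbF mul0r mulr0 addr0 hS.
have [mL|mL] := boolP (m \in L); last by rewrite mul0r mulr0 addr0 h0.
rewrite add0r /= mulNr mulrN rmorphV ?unitfE; last first.
  by apply: contra (lam0 m mL mS) => /eqP->.
have := hL m mL mS => /eqP; rewrite addr_eq0 => /eqP h.
apply: (mulfI (lam0 m mL mS)); rewrite h mulrN mulrCA mulVKf //.
exact: lam0.
Qed.

End Lattice.

(** * The reduction and the equivalence *)

Theorem proposition1 (R : realType)
    (W : R -> R -> R) (w : Z2 -> R[i]) (sigma Omega : R) (n : nat * nat)
    (W_bounded : bounded2 W)
    (W_periodic : periodic2pi W)
    (W_fourier : fourier_expansion W w)
    (w_l2s : forall s : R, 1 < s -> l2s (sublattice (0, 0)%N) s w)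
    (delta : R) (delta_gt0 : 0 < delta) :
  exists (C : R) (A : R -> 'rV[R[i]]_(dS n) -> 'rV[R[i]]_(dS n)) (epsbar : R),
    [/\ 0 < C, 0 < epsbar,
        (forall eps0 : R, 0 < eps0 <= epsbar ->
           (forall a, l1norm a < delta ->
              analytic_near0 eps0 (fun eps => A eps a)) /\
           (forall eps : R, `|eps| < eps0 ->
              forall a, l1norm a < delta ->
              l1norm (A eps a) <= C * l1norm a)) &
        (forall rho : R, 0 < rho ->
           exists2 eps0 : R, 0 < eps0 <= epsbar &
           forall eps : R, 0 < `|eps| < eps0 ->
             (forall a, l1norm a < delta ->
                reduction_at w sigma Omega eps delta rho A a) /\
             ((exists U : Z2 -> R[i],
                 [/\ lattice_solution w sigma
                       ((normsq (natZ2 n))%:~R / 4 + eps * Omega) eps n U,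
                     nontrivial_on (sublattice n) U &
                     in_region n delta rho U])
              <->
              (exists a : 'rV[R[i]]_(dS n),
                 [/\ a != 0, l1norm a < delta &
                     bif_solution w sigma Omega eps A a])))].
Proof.
pose E := sublattice (0, 0)%N; pose L := sublattice n; pose wE := restr E w.
have hwp p : l1w (@wt R) p wE.
  by apply: l2s_l1w; apply: w_l2s; rewrite ltr1n; lia.
have lw : l1 wE by exact: l1w_l1 (@wt_ge1 R) _ _ (hwp 0%N).
have [Wn hW] := lw.
pose K : R := `|Omega| + Wn + `|sigma|.
have K0 : 0 <= K by rewrite !addr_ge0 // (sumle_ge0 hW).
pose B : R := K * (2 + 8 * delta ^+ 2).
have B0 : 0 <= B by rewrite mulr_ge0 // addr_ge0 // mulr_ge0 // sqr_ge0.
(* 4 bounds the resolvent, so this is the smallness required by the majorant argument; the added 1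
   covers B = 0. *)
pose e : R := (4 * B + 1)^-1.
have e0 : 0 < e by rewrite invr_gt0; lra.
have eB : e * (4 * B) <= 1.
  by rewrite mulrC ler_pdivrMr; lra.
pose r : Z2 -> R[i] := resolvent R n.
have hr m : cnorm (r m) <= 4 by exact: resolvent_le.
pose A eps (a : 'rV[R[i]]_(dS n)) : 'rV[R[i]]_(dS n) :=
  \row_j remainder wE Omega sigma r (ext a) eps (mode j).
have coefA eps a m : m \in Sn n ->
    coef (A eps a) m = remainder wE Omega sigma r (ext a) eps m.
  by move=> /in_mode[j ->]; rewrite coef_mode mxE.
have sol_fix := fun (eps : R) (a : 'rV[R[i]]_(dS n)) (he : `|eps| < e)
    (ha : l1norm a < delta) =>
  sol_fixpoint hW hr e0 (sumle_ext a) (ltW ha) eB he.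
exists (e^-1 * B + 1), A, e; split => //.
- by rewrite ltr_wpDl // mulr_ge0 // invr_ge0 ltW.
- move=> eps0 /andP[eps0_gt0 eps0_le]; split=> [a ha|eps he a ha].
    exists (fun k => \row_j rem_coef wE Omega sigma r (ext a) k (mode j)).
    move=> eps he j; have he' := lt_le_trans he eps0_le.
    have hm := maj_rem_coef hW hr e0 (sumle_ext a) (ltW ha) eB.
    have hc := lim_to_cvg (has_sum_lim_to (has_sum_psum e0 he' (mode j) hm)).
    rewrite mxE (_ : series _ = (fun N => \sum_(0 <= i < N)
      eps%:C ^+ i * rem_coef wE Omega sigma r (ext a) i (mode j))) //.
    by apply/funext => N; apply: eq_bigr => k _; rewrite mxE mulrC.
  have he' := lt_le_trans he eps0_le.
  have hs := sumle_remainder hW hr e0 (sumle_ext a) (ltW ha) eB he'.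
  rewrite l1normE; under eq_big_seq => m mS do rewrite coefA //.
  apply: le_trans (hs _ (fset_uniq _)) _.
  by rewrite ler_wpM2r ?lerDl // (sumle_ge0 (sumle_ext a)).
(* [M] dominates 2 delta, the bound of the series solution, and delta + rho, the bound of an
   arbitrary solution in the region. *)
move=> rho rho0; pose M : R := 3 * delta + rho.
pose th : R := 4 * (K * (1 + 3 * M ^+ 2)).
have th0 : 0 <= th by rewrite !mulr_ge0 // addr_ge0 // mulr_ge0 // sqr_ge0.
have Bd0 : 0 <= 4 * (B * delta).
  by apply: mulr_ge0 => //; apply: mulr_ge0 => //; exact: ltW.
have q1 : 0 < rho / (4 * (B * delta) + 1) by apply: divr_gt0 => //; lra.
have q2 : 0 < (th + 1)^-1 by rewrite invr_gt0; lra.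
(* Respectively: convergence of the series, nonresonant part below [rho], contraction on the ball of
   radius [M]. *)
exists (Num.min e (Num.min (rho / (4 * (B * delta) + 1)) (th + 1)^-1)).
  by rewrite !lt_min e0 q1 q2 /= ge_min lexx.
move=> eps; rewrite !lt_min => /andP[eps_gt0 /and3P[he he1 he2]].
have {}he1 : `|eps| * (4 * (B * delta)) < rho.
  by move: he1; rewrite ltr_pdivlMr; [have := ltW eps_gt0; nra|lra].
have {}he2 : `|eps| * th < 1.
  by move: he2; rewrite -[_^-1]mul1r ltr_pdivlMr; [have := ltW eps_gt0; nra|lra].
have eps0 : eps%:C != 0 :> R[i].
  by apply/eqP => /complexI h; move: eps_gt0; rewrite h normr0 ltxx.
have red a : l1norm a < delta ->
    reduction_at w sigma Omega eps delta rho A a.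
  move=> ha; pose V := sol wE Omega sigma r (ext a) eps.
  have hV := sol_fix eps a he ha.
  have [V0 VS VL] := (fixpoint_lattice w sigma Omega eps a V).1 hV.
  have rV : restr L V = V.
    by apply/funext => m; rewrite /restr; case: ifPn => // /V0->.
  have lV : l1 V.
    exists (2 * l1norm a).
    exact: (sumle_sol hW hr e0 (sumle_ext a) (ltW ha) eB he).
  exists V; split.
  - move=> s _; apply: l1w_l2s => p; rewrite -/L rV.
    apply: (fixpoint_regular (@wt_ge1 R) (@wtN R) _ (@wtD R)
              (@wt_resolvent_le R n) lV hwp _ hV) => // q.
    exact: l1w_ext.
  - split; first by rewrite (eq_big_seq _ (fun m mS => congr1 _ (VS m mS))) -l1normE.
    apply: le_lt_trans (esum_le (M := `|eps| * (4 * (B * l1norm a))) _) _.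
      move=> s us sD.
      apply: le_trans (sumle_sol_sub hW hr e0 (sumle_ext a) (ltW ha) eB he us).
      rewrite big_seq_cond [leRHS]big_seq_cond; apply: ler_sum => m.
      rewrite andbT => /sD[_ mS]; rewrite [ext a m]/ext ifN ?subr0 //.
      by rewrite in_Sn; apply/negP => /set_mem.
    rewrite lte_fin; apply: le_lt_trans he1.
    by rewrite ler_wpM2l // ler_wpM2l // ler_wpM2l // ltW.
  - exact: VS.
  - move=> m /mem_set mL; rewrite lattice_defectE ?rV //.
    case: ifPn => mS; last exact: VL.
    rewrite coefA // (bif_lhsE w sigma Omega a mS).
    rewrite (pert_sol hW hr e0 (sumle_ext a) (ltW ha) eB he m).
    move: mS; rewrite Sn_normsq // /lam => /eqP->.
    by rewrite subrr mul0r mul0r add0r.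
split=> //; split=> [[U [[Ul2 Ud] [m0 m0L Um0] [US UL]]]|[a [a0 ha hbif]]]; last first.
  have [U [Ul2 Ureg US Ud]] := red a ha; exists U; split=> //.
    split=> // m mL; rewrite Ud //; case: ifP => // mS.
    by rewrite hbif // subrr mulr0.
  have [j aj] : exists j, a 0 j != 0.
    apply/existsP; apply: contraNT a0 => /existsPn h; apply/eqP/rowP => j.
    by rewrite mxE; apply/eqP; rewrite -[_ == _]negbK h.
  exists (mode j); first exact/set_mem/Sn_sublattice/mode_in.
  by rewrite US ?mode_in // coef_mode.
pose a : 'rV[R[i]]_(dS n) := \row_j U (mode j).
have aU m : m \in Sn n -> coef a m = U m.
  by move=> /in_mode[j ->]; rewrite coef_mode mxE.
have ha : l1norm a < delta.
  by rewrite l1normE (eq_big_seq _ (fun m mS => congr1 _ (aU m mS))).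
pose V := restr L U.
have hV : sumle V (delta + rho).
  have h1 : sumle (restr (L `\` resonant_set n) U) rho.
    move=> s us; apply: le_trans (esum_lt_sum (fun m => cnorm_ge0 (U m)) UL us).
    by apply: ler_sum => m _; rewrite /restr; case: ifP => //; rewrite cnorm0.
  apply: (sumle_le _ (sumleD (sumle_weaken (ltW ha) (sumle_ext a)) h1)) => m.
  rewrite /V /ext /restr in_setD -in_Sn.
  case: ifPn => [mL|_]; last by rewrite cnorm0 cnorm_ge0.
  by case: ifPn => [/aU->|_]; rewrite ?andbF ?andbT ?addr0 ?add0r.
have lV : l1 V by exists (delta + rho).
have Vdef m : m \in L ->
    (lam R n m)%:C * U m + eps%:C * pert wE Omega sigma V m = 0.
  by move=> mL; rewrite -lattice_defectE // Ud //; exact: set_mem.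
have fixV : forall m, V m = ext a m + eps%:C * (r m * pert wE Omega sigma V m).
  apply/fixpoint_lattice; split=> m.
  - by rewrite /V /restr => /negbTE->.
  - by move=> mS; rewrite /V restr_pick ?aU // Sn_sublattice.
  - by move=> mL _; rewrite /V restr_pick // Vdef.
have hsol := sumle_sol hW hr e0 (sumle_ext a) (ltW ha) eB he.
(* Uniqueness identifies the given solution with the series, so its equations on S_n carry precisely
   the remainder [A]. *)
have Vsol : V = sol wE Omega sigma r (ext a) eps.
  apply: (fixpoint_unique hW hr fixV (sol_fix eps a he ha) (M := M)) => //.
    by apply: sumle_weaken hV; rewrite /M; lra.
  by apply: sumle_weaken hsol; rewrite /M; lra.
exists a; split=> //.
  (* The bound 2 |a| on the series solution is linear, so a = 0 would make U vanish on the whole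
     sublattice. *)
  apply: contra_neq Um0 => a0.
  have : cnorm (V m0) <= 2 * l1norm a by rewrite Vsol; exact: sumle_point hsol.
  rewrite /V restr_pick; last exact/mem_set.
  rewrite a0 /l1norm big1 => [|j _]; last by rewrite mxE cnorm0.
  rewrite mulr0 => h; apply: cnorm0_eq0; apply/eqP.
  by rewrite eq_le h cnorm_ge0.
move=> m mS; have mL := Sn_sublattice mS.
have := Vdef m mL.
rewrite Vsol (pert_sol hW hr e0 (sumle_ext a) (ltW ha) eB he m).
rewrite -(bif_lhsE w sigma Omega a mS) coefA //.
move: (mS); rewrite Sn_normsq // /lam => /eqP->.
rewrite subrr mul0r mul0r add0r => /eqP.
by rewrite mulf_eq0 (negbTE eps0) subr_eq0 => /eqP.
Qed.
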